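(* Let $k\ge 3$ be an integer. There exist constants $c=c(k)>0$ and $n_0=n_0(k)$ such that every graph $G$ on $n\ge n_0$ vertices with $m$ edges satisfying \[ \sum_{v\in V(G)} d^2(v)> 2\left(1-\frac1k\right)mn \] contains a copy of $K_k^{+}[t]$ for some $t\ge c\log n$, has $js_{k+1}(G)\ge c\,n^{k-1}$, and contains a copy of $B_{k,t}$ for some $t\ge c\,n$.
   Context: All graphs are finite and simple; $d(v)$ is the degree of $v$. $K_k^{+}[t]$ is obtained from the complete $k$-partite graph with all parts of size $t$ by adding one edge inside one part. $js_{k+1}(G)$ is the maximum, over all edges $uv$ of $G$, of the number of copies of $K_{k+1}$ containing both $u$ and $v$. $B_{k,t}=K_k\vee I_t$ is the graph consisting of a clique on $k$ vertices and an independent set of $t$ vertices, each clique vertex adjacent to each vertex of the independent set. *)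

(* Defs.v *)
From Stdlib Require Import Reals.
From mathcomp Require Import all_boot.

Set Implicit Arguments.
Unset Strict Implicit.
Unset Printing Implicit Defensive.

Definition simple_graph (T : finType) (G : rel T) : Prop :=
  symmetric G /\ irreflexive G.

Definition deg (T : finType) (G : rel T) (v : T) : nat := #|[set w | G v w]|.

Definition num_edges (T : finType) (G : rel T) : nat :=
  #|[set e : {set T} | [exists u, exists v, (e == [set u; v]) && G u v]]|.

Definition sum_deg2 (T : finType) (G : rel T) : nat :=
  \sum_(v : T) deg G v ^ 2.

Definition contains_copy (T : finType) (G : rel T) (U : finType) (H : rel U) : Prop :=
  exists f : U -> T, injective f /\ forall x y, H x y -> G (f x) (f y).

(* K_k^+[t]: complete k-partite graph with parts of size t (vertex (i,a) is the
   a-th vertex of part i), plus one edge inside part 0, namely (0,0)-(0,1). *)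
Definition Kplus_rel (k t : nat) : rel ('I_k * 'I_t) :=
  fun x y =>
    (x.1 != y.1) ||
    [&& (val x.1 == 0), (val y.1 == 0) &
        ((val x.2 == 0) && (val y.2 == 1)) || ((val x.2 == 1) && (val y.2 == 0))].

Definition B_rel (k t : nat) : rel ('I_k + 'I_t) :=
  fun x y =>
    match x, y with
    | inl i, inl j => i != j
    | inl _, inr _ => true
    | inr _, inl _ => true
    | inr _, inr _ => false
    end.

Definition is_clique (T : finType) (G : rel T) (S : {set T}) : bool :=
  [forall u in S, forall v in S, (u != v) ==> G u v].

Definition num_Kr_through (T : finType) (G : rel T) (r : nat) (u v : T) : nat :=
  #|[set S : {set T} | [&& #|S| == r, is_clique G S, u \in S & v \in S]]|.

(* js_{r}(G) = max over edges uv of the number of copies of K_r containing u,v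
   (0 if G has no edges). *)
Definition js (T : finType) (G : rel T) (r : nat) : nat :=
  \max_(p : T * T | G p.1 p.2) num_Kr_through G r p.1 p.2.

(* Main.v *)
Require Import Defs.
From Stdlib Require Import Reals.
From mathcomp Require Import all_boot all_order all_algebra.
From mathcomp Require Import zify ring lra.
Set Implicit Arguments.
Unset Strict Implicit.
Unset Printing Implicit Defensive.
Import Order.TTheory GRing.Theory Num.Theory.

(** Let k_s be the number of s-cliques. The Moon-Moser inequalities propagate the
hypothesis, which says that 3 k_3 > (1 - 2/k) n k_2, up to k_{k+1} > 0, the
excess of (r+1) k_{r+1} / (n k_r) over 1 - r/k being nondecreasing in r.

If the last excess is bounded below, then G has at least c n^{k+1} cliques of
order k+1, and averaging yields an edge uv whose common neighbourhood contains at
least c n^{k-1} cliques of order k-1, each with at least c n common neighbours.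
Otherwise the inequalities are almost tight, so almost all degrees are close to
(1 - 1/k) n. Deleting the few vertices of small degree preserves the hypothesis,
hence leaves a (k+1)-clique with all degrees large; by convexity two of its
vertices u, v have clearly more than (1 - 2/k) n common neighbours, in which
(k-1)-cliques can be chosen greedily, so again uv is an edge as above.

Such an edge gives the joint and, by averaging over (k-2)-cliques, the book B_{k,t}.
For K_k^+[t], an Erdos-Stone type induction, pigeonholing over the neighbourhoods
of vertices in log n disjoint cliques, finds a K_k[t] with k-1 parts in the common
neighbourhood of u and v; adding uv to the remaining part finishes the proof. *)

(** * Cliques and common neighbourhoods *)

Section Cliques.
Variables (T : finType) (G : rel T).
Hypotheses (Gsym : symmetric G) (Girr : irreflexive G).
Implicit Types (S Q R : {set T}) (r : nat).

Definition cliques S r : {set {set T}} :=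
  [set Q : {set T} | [&& #|Q| == r, is_clique G Q & Q \subset S]].

Definition cnbr S Q : {set T} := [set x in S | [forall y in Q, G y x]].

Lemma cnbrP S Q x :
  reflect (x \in S /\ {in Q, forall y, G y x}) (x \in cnbr S Q).
Proof.
rewrite inE; apply: (iffP andP) => -[xS].
  by move=> /forall_inP h; split.
by move=> h; split=> //; apply/forall_inP.
Qed.

Lemma is_cliqueP Q :
  reflect {in Q &, forall u v, u != v -> G u v} (is_clique G Q).
Proof.
apply: (iffP forall_inP) => [h u v uQ vQ uv|h u uQ].
  by have /forall_inP/(_ v vQ)/implyP := h u uQ; apply.
by apply/forall_inP => v vQ; apply/implyP; apply: h.
Qed.

Lemma cnbr_notin S Q x : x \in cnbr S Q -> x \notin Q.
Proof. by case/cnbrP=> _ h; apply/negP => /h; rewrite Girr. Qed.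

Lemma cliques_card S r Q : Q \in cliques S r -> #|Q| = r.
Proof. by rewrite inE => /and3P[/eqP]. Qed.

Lemma cliquesS S S' r : S \subset S' -> cliques S r \subset cliques S' r.
Proof.
move=> sS; apply/subsetP => Q; rewrite !inE => /and3P[-> -> QS] /=.
exact: subset_trans QS sS.
Qed.

Lemma setU1_clique S Q x r : x \notin Q ->
  (x |: Q \in cliques S r.+1) = (Q \in cliques S r) && (x \in cnbr S Q).
Proof.
move=> xQ; apply/idP/andP.
  rewrite !inE cardsU1 xQ subUset sub1set eqSS => /and3P[-> /is_cliqueP h /andP[xS QS]].
  rewrite QS xS /= andbT; split.
    by apply/is_cliqueP => u v uQ vQ; apply: h; rewrite inE ?uQ ?vQ orbT.
  apply/forall_inP => y yQ; apply: h; rewrite ?setU11 ?setU1r //.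
  by apply: contraNneq xQ => <-.
case; rewrite inE => /and3P[/eqP cQ /is_cliqueP h QS] /cnbrP[xS hx].
rewrite !inE cardsU1 xQ cQ eqxx subUset sub1set xS QS /= andbT.
apply/is_cliqueP => u v /setU1P[->|uQ] /setU1P[->|vQ]; rewrite ?eqxx //.
- by rewrite Gsym => _; apply: hx.
- by move=> _; apply: hx.
- exact: h.
Qed.

(** Pairs (R, v) with v in the (r+1)-clique R correspond to pairs (Q, v) with v a common neighbour
    of the r-clique Q, through Q = R minus v. The double counts of cliques below rest on this. *)
Lemma clique_exchange (V : nmodType) S r (F : {set T} -> T -> V) :
  (\sum_(R in cliques S r.+1) \sum_(v in R) F (R :\ v) v =
   \sum_(Q in cliques S r) \sum_(v in cnbr S Q) F Q v)%R.
Proof.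
rewrite !pair_big_dep /=.
rewrite (reindex_onto (fun p => (p.2 |: p.1, p.2)) (fun p => (p.1 :\ p.2, p.2))) /=;
  last by move=> [R v] /= /andP[_ vR]; rewrite setD1K.
have E (Q : {set T}) v : ((v |: Q) :\ v == Q) = (v \notin Q).
  apply/eqP/idP => [<-|vQ]; first by rewrite !inE eqxx.
  by rewrite setU1K.
apply: eq_big => [[Q v]|[Q v]] /=; last first.
  by case/andP=> _ /eqP[->].
rewrite xpair_eqE eqxx andbT E setU11 andbT.
have [vQ|vQ] := boolP (v \in Q); last by rewrite setU1_clique ?andbT.
rewrite andbF; apply/esym/negbTE; rewrite negb_and orbC.
by apply/orP; left; apply: contraL vQ; apply: cnbr_notin.
Qed.

Lemma card_cliquesS S r :
  r.+1 * #|cliques S r.+1| = \sum_(Q in cliques S r) #|cnbr S Q|.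
Proof.
have E : \sum_(R in cliques S r.+1) \sum_(v in R) 1 =
  \sum_(Q in cliques S r) \sum_(v in cnbr S Q) 1 := clique_exchange S r (fun _ _ => 1%N).
under [RHS]eq_bigr => Q _ do rewrite -sum1_card.
rewrite -E mulnC -sum_nat_const; apply: eq_bigr => R RK.
by rewrite -(cliques_card RK) -sum1_card.
Qed.

(** A vertex x adjacent to all of R is counted |R| times. Any other x misses some y in R, so only
    the term v = y can count it. *)
Lemma cnbr_remove1 S R : R != set0 ->
  \sum_(v in R) #|cnbr S (R :\ v)| <= #|S| + #|R|.-1 * #|cnbr S R|.
Proof.
move=> R0.
have -> : \sum_(v in R) #|cnbr S (R :\ v)| =
    \sum_(x in S) #|[set v in R | x \in cnbr S (R :\ v)]|.
  under eq_bigr => v _ do rewrite -sum1_card.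
  rewrite (exchange_big_dep (mem S)) /=; last by move=> v x _ /cnbrP[].
  apply: eq_bigr => x _; rewrite -sum1_card; apply: eq_bigl => v.
  by rewrite inE.
have -> : #|S| + #|R|.-1 * #|cnbr S R| =
    \sum_(x in S) (1 + #|R|.-1 * (x \in cnbr S R)).
  rewrite big_split /= sum1_card -big_distrr /=; congr (_ + _ * _).
  rewrite -sum1_card big_mkcond [RHS]big_mkcond; apply: eq_bigr => x _.
  by rewrite [x \in cnbr _ _]inE; case: (x \in S).
apply: leq_sum => x xS.
have [xR|xR] := boolP (x \in cnbr S R).
  rewrite muln1 add1n prednK ?card_gt0 //.
  by apply: subset_leq_card; apply/subsetP => v; rewrite inE => /andP[].
rewrite muln0 addn0.
have [y yR /negP nG] : exists2 y, y \in R & ~~ G y x.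
  apply/exists_inP; apply: contraR xR; rewrite negb_exists_in => /forall_inP h.
  by apply/cnbrP; split=> // y /h /negPn.
rewrite -(cards1 y); apply: subset_leq_card; apply/subsetP => v.
rewrite !inE => /and3P[vR _ /forall_inP h]; apply: contraT => vy.
by case: nG; apply: h; rewrite !inE eq_sym vy.
Qed.

(** By [clique_exchange] the sum of squares runs over pairs (R, v) with summand the number of common
    neighbours of R minus v; [cnbr_remove1] bounds it for each R. *)
Lemma moon_moser S r :
  \sum_(Q in cliques S r) #|cnbr S Q| ^ 2 <=
  #|S| * #|cliques S r.+1| + r * (r.+2 * #|cliques S r.+2|).
Proof.
have -> : \sum_(Q in cliques S r) #|cnbr S Q| ^ 2 =
    \sum_(R in cliques S r.+1) \sum_(v in R) #|cnbr S (R :\ v)|.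
  rewrite [RHS](clique_exchange S r (fun Q _ => #|cnbr S Q|)).
  by apply: eq_bigr => Q _; rewrite sum_nat_const mulnn.
rewrite card_cliquesS big_distrr /= mulnC -sum_nat_const -big_split /=.
apply: leq_sum => R RK; have cR := cliques_card RK.
have := cnbr_remove1 S (R := R); rewrite cR; apply.
by rewrite -card_gt0 cR.
Qed.

Lemma card_cliques_le S r : #|cliques S r| <= #|S| ^ r.
Proof.
elim: r => [|r IH].
  rewrite expn0 -[leqRHS](cards1 (set0 : {set T})).
  apply: subset_leq_card; apply/subsetP => Q; rewrite !inE => /and3P[].
  by rewrite cards_eq0.
apply: (@leq_trans (r.+1 * #|cliques S r.+1|)); first exact: leq_pmull.
rewrite card_cliquesS expnSr; apply: leq_trans (leq_mul IH (leqnn _)).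
rewrite -sum_nat_const; apply: leq_sum => Q _; apply: subset_leq_card.
by apply/subsetP => x /cnbrP[].
Qed.

End Cliques.

(** * Complete multipartite subgraphs from many cliques *)

(** Classify the vertices x by the trace [J x], the set of indices a with x in [B a]. There are only
    2^s traces, so some trace K of size at least s/(2C) is shared by at least n/(2C 2^s) vertices,
    and 4^s <= n makes this at least s/(2C). The indices in K and the vertices with trace K are
    completely joined. *)
Lemma dense_bipartite_common (T : finType) (s C : nat) (B : nat -> {set T}) :
  4 ^ s <= #|T| -> (forall a, a < s -> #|T| <= C * #|B a|) ->
  exists s' (g : nat -> nat) (h : nat -> T),
    [/\ s <= 2 * C * s', s' <= s, {homo g : b / b < s' >-> b < s},
        {in gtn s' &, injective g} /\ {in gtn s' &, injective h}
      & forall b c, b < s' -> c < s' -> h c \in B (g b)].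
Proof.
move=> n4 dense; set n := #|T| in n4 dense.
have n0 : 0 < n by apply: leq_trans n4; rewrite expn_gt0.
have /card_gt0P[x0 _] := n0.
(* The case s = 0 is separate because the default [ord0] used with [nth] below needs ['I_s] to be
   inhabited. *)
case: s => [|s'] in n4 dense *.
  by exists 0, id, (fun=> x0); split=> //; split=> ?.
set s := s'.+1 in n4 dense *.
pose J (x : T) := [set a : 'I_s | x \in B a].
have [K [Ks Kn]] : exists K : {set 'I_s},
    s <= 2 * C * #|K| /\ n <= 2 * C * 2 ^ s * #|[set x | J x == K]|.
  have [/existsP[K /andP[? ?]]|no] := boolP [exists K : {set 'I_s},
    (s <= 2 * C * #|K|) && (n <= 2 * C * 2 ^ s * #|[set x | J x == K]|)].
    by exists K.
  exfalso.
  pose X0 := [set x | s <= 2 * C * #|J x|].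
  (* If all classes with a large trace are small, their union [X0] has fewer than n/(2C)
     vertices. *)
  have X0n : 2 * C * #|X0| < n.
    have -> : #|X0| = \sum_(K : {set 'I_s} | s <= 2 * C * #|K|) #|[set x | J x == K]|.
      rewrite -sum1_card (partition_big J (fun K : {set 'I_s} => s <= 2 * C * #|K|)) /=;
        last by move=> x; rewrite inE.
      apply: eq_bigr => K hK; rewrite -sum1_card; apply: eq_bigl => x.
      by rewrite !inE andbC; case: eqP => // ->.
    have p0 : 0 < 2 ^ s by rewrite expn_gt0.
    rewrite -(ltn_pmul2r p0) big_distrr /= big_distrl /=.
    apply: (@leq_ltn_trans (\sum_(K : {set 'I_s}) n.-1)).
      rewrite [leqLHS]big_mkcond; apply: leq_sum => K _; case: ifP => // hK.
      move: no; rewrite negb_exists => /forallP/(_ K); rewrite hK /= -ltnNge.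
      rewrite -(ltn_predK n0) ltnS; apply: leq_trans; rewrite eq_leq //; ring.
    rewrite sum_nat_const -cardsT -powersetT card_powerset cardsT card_ord.
    by rewrite mulnC ltn_pmul2r // prednK.
  (* Incidences are counted twice. Scaled by 2C, density gives at least 2sn, whereas vertices
     outside [X0] contribute at most s each and those in [X0] at most 2Cs each, in total less than
     2sn. *)
  have tot : \sum_x #|J x| = \sum_(a < s) #|B a|.
    under eq_bigr => x _ do rewrite -sum1_card.
    rewrite (exchange_big_dep predT) //=; apply: eq_bigr => a _.
    by rewrite -sum1_card; apply: eq_bigl => x; rewrite inE.
  have lo : 2 * (s * n) <= \sum_x 2 * C * #|J x|.
    rewrite -big_distrr /= tot -mulnA leq_pmul2l // big_distrr /=.
    apply: (@leq_trans (\sum_(a < s) n)); first by rewrite sum_nat_const card_ord.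
    by apply: leq_sum => a _; apply: dense.
  have hi : \sum_x 2 * C * #|J x| <= \sum_x (s + 2 * C * s * (x \in X0)).
    apply: leq_sum => x _; case: (boolP (x \in X0)) => [_|].
      rewrite muln1; apply: leq_trans (leq_addl _ _); rewrite leq_mul2l.
      by rewrite -[X in _ <= X](card_ord s) max_card orbT.
    by rewrite inE -ltnNge muln0 addn0 => /ltnW.
  have := leq_trans lo hi; rewrite big_split /= sum_nat_const -big_distrr /=.
  have -> : \sum_x (x \in X0 : nat) = #|X0| 
    by rewrite -sum1_card [RHS]big_mkcond; apply: eq_bigr => x _; case: (x \in X0).
  rewrite (_ : #|_| = n) // leqNgt => /negP; apply.
  rewrite -mulnAC (_ : 2 * (s * n) = n * s + n * s); last by rewrite mul2n -addnn mulnC.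
  by rewrite ltn_add2l ltn_pmul2r.
pose X := [set x | J x == K].
have hX : s <= 2 * C * #|X|.
  have p0 : 0 < 2 ^ s by rewrite expn_gt0.
  apply: (@leq_trans (2 ^ s)); first exact/ltnW/ltn_expl.
  rewrite -(leq_pmul2r p0) -expnMn; apply: leq_trans n4 (leq_trans Kn _).
  by rewrite eq_leq // mulnAC.
exists (minn #|K| #|X|), (nth 0 (map val (enum K))), (nth x0 (enum X)).
have szK b : b < minn #|K| #|X| -> b < size (enum K).
  by rewrite -cardE leq_min => /andP[].
have szX b : b < minn #|K| #|X| -> b < size (enum X).
  by rewrite -cardE leq_min => /andP[].
split.
- by rewrite /minn; case: ifP.
- by apply: leq_trans (geq_minl _ _) _; rewrite -[leqRHS](card_ord s) max_card.
- by move=> b /szK hb; rewrite (nth_map ord0) ?ltn_ord.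
- split=> b c; rewrite !inE => hb hc.
    move/eqP; rewrite nth_uniq ?size_map; [by move/eqP|exact: szK..|].
    by rewrite map_inj_uniq ?enum_uniq //; apply: val_inj.
  by move/eqP; rewrite nth_uniq ?enum_uniq ?szX // => /eqP.
move=> b c hb hc.
have := mem_nth x0 (szX c hc); set x := nth x0 _ _.
rewrite mem_enum inE => /eqP Jx.
rewrite (nth_map ord0) ?szK //; have := mem_nth ord0 (szK b hb).
by rewrite mem_enum -Jx inE.
Qed.

Section Blowup.
Variables (T : finType) (G : rel T).
Hypotheses (Gsym : symmetric G) (Girr : irreflexive G).

(* Keeping the s disjoint transversals {f 0 a, f 1 a, ...} inside QQ is what makes
   the induction on the number r of parts go through with s of order log n. *)
Definition aligned_blowup (QQ : {set {set T}}) r s (f : nat -> nat -> T) : Prop :=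
  [/\ forall a, a < s -> [set f (val i) a | i : 'I_r] \in QQ,
      forall i, i < r -> {in gtn s &, injective (f i)}
    & forall i j a b, i < r -> j < r -> a < s -> b < s -> i != j ->
        G (f i a) (f j b)].

(** Averaging: there are (r+1)|QQ| >= n^(r+1)/C extensions in all. The r-cliques with fewer than
    n/(2C) of them account for at most half of this bound, and every other one has at most n. *)
Lemma many_extensions r C (QQ : {set {set T}}) :
  QQ \subset cliques G setT r.+1 -> 0 < #|T| -> #|T| ^ r.+1 <= C * #|QQ| ->
  #|T| ^ r <= 2 * C * #|[set P in cliques G setT r |
     #|T| <= 2 * C * #|[set x in cnbr G setT P | x |: P \in QQ]| ]|.
Proof.
move=> sQ n0; set n := #|T| in n0 * => hQ.
pose ext P := [set x in cnbr G setT P | x |: P \in QQ].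
pose QQ' := [set P in cliques G setT r | n <= 2 * C * #|ext P| ].
have E : \sum_(P in cliques G setT r) #|ext P| = r.+1 * #|QQ|.
  have E : \sum_(R in cliques G setT r.+1) \sum_(v in R) (R \in QQ) =
     \sum_(Q in cliques G setT r) \sum_(v in cnbr G setT Q) (v |: Q \in QQ).
    rewrite -[RHS](clique_exchange Gsym Girr (V := nat) setT r
       (fun Q v => (v |: Q \in QQ) : nat)).
    by apply: eq_bigr => R _; apply: eq_bigr => v vR; rewrite setD1K.
  transitivity (\sum_(R in cliques G setT r.+1) \sum_(v in R) (R \in QQ)).
    rewrite E; apply: eq_bigr => P _; rewrite -sum1_card -big_mkcondr /=.
    by apply: eq_bigl => x; rewrite inE.
  transitivity (\sum_(R in cliques G setT r.+1 | R \in QQ) r.+1).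
    rewrite big_mkcondr; apply: eq_bigr => R RK.
    by rewrite sum_nat_const (cliques_card RK); case: (R \in QQ); rewrite ?muln0 ?muln1.
  rewrite sum_nat_const mulnC; congr (_ * _); apply: eq_card => R.
  by rewrite [LHS]andbC; case: (boolP (R \in QQ)) => // /(subsetP sQ).
have hi : \sum_(P in cliques G setT r) 2 * C * #|ext P| <=
    n * n ^ r + 2 * C * n * #|QQ'|.
  apply: (@leq_trans (\sum_(P in cliques G setT r) (n + 2 * C * n * (P \in QQ')))).
    apply: leq_sum => P PK; case: (boolP (P \in QQ')) => [_|].
      by rewrite muln1 -[leqLHS]add0n leq_add // leq_mul2l max_card orbT.
    by rewrite inE PK -ltnNge => /ltnW/leq_trans; apply; apply: leq_addr.
  rewrite big_split /= sum_nat_const leq_add //.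
    by rewrite mulnC leq_mul2l /n -cardsT card_cliques_le ?orbT.
  rewrite -big_distrr leq_mul2l -sum1_card; apply/orP; right.
  rewrite [leqRHS]big_mkcond [leqLHS]big_mkcond; apply: leq_sum => P _.
  by case: ifP.
rewrite -(leq_pmul2l n0) -expnS.
rewrite -big_distrr /= E in hi.
have h1 : 2 * C * #|QQ| <= 2 * C * (r.+1 * #|QQ|) by rewrite leq_mul2l leq_pmull ?orbT.
have := leq_trans h1 hi; rewrite -expnS => h2.
have h3 : 2 * n ^ r.+1 <= n ^ r.+1 + 2 * C * n * #|QQ'|.
  by apply: leq_trans h2; rewrite -mulnA leq_mul2l.
by move: h3; rewrite mul2n -addnn leq_add2l mulnCA !mulnA.
Qed.

(** Each new part costs a factor 4C in s, from [dense_bipartite_common] with constant 2C, and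
    doubles the density constant, from [many_extensions]. *)
Fixpoint blowup_const r C := if r is r'.+1 then 4 * C * blowup_const r' (2 * C) else 1.

(** Induction on r: the hypothesis is applied to the r-cliques with many extensions in QQ, and
    [dense_bipartite_common] then picks transversals and new vertices such that every new vertex
    extends every chosen transversal within QQ. The bound [s' <= s] keeps 4^s' <= n available for
    that step. *)
Lemma aligned_blowup_exists r C s (QQ : {set {set T}}) :
  QQ \subset cliques G setT r -> 4 ^ s <= #|T| -> #|T| ^ r <= C * #|QQ| ->
  exists s' f, [/\ s <= blowup_const r C * s', s' <= s & aligned_blowup QQ r s' f].
Proof.
move=> + n4; have n0 : 0 < #|T| by apply: leq_trans n4; rewrite expn_gt0.
have /card_gt0P[x0 _] := n0.
elim: r C QQ => [|r IH] C QQ sQ hQ.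
  exists s, (fun _ _ => x0); split; rewrite ?mul1n //; split=> // a _.
  have /card_gt0P[Q QQQ] : 0 < #|QQ| by case: #|QQ| hQ; rewrite ?muln0.
  suff -> : [set x0 | _ : 'I_0] = Q by [].
  have /cliques_card/eqP := subsetP sQ _ QQQ; rewrite cards_eq0 => /eqP ->.
  by apply/setP => x; rewrite inE; apply/imsetP => -[[]].
have := many_extensions sQ n0 hQ; set QQ' := [set P in _ | _] => hQ'.
have sQ' : QQ' \subset cliques G setT r by apply/subsetP => P; rewrite inE => /andP[].
have [s1 [f [h1 h2 [f1 f2 f3]]]] := IH _ _ sQ' hQ'.
pose P a := [set f (val i) a | i : 'I_r].
have n4' : 4 ^ s1 <= #|T| by apply: leq_trans n4; rewrite leq_exp2l.
have [a ha|s2 [g [h [k1 k2 k3 [k4 k5] k6]]]] :=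
  @dense_bipartite_common T s1 (2 * C)
    (fun a => [set x in cnbr G setT (P a) | x |: P a \in QQ]) n4'.
  by have := f1 a ha; rewrite inE => /andP[].
pose f' i b := if i < r then f i (g b) else h b.
exists s2, f'; split.
- rewrite /=; apply: (leq_trans h1); rewrite mulnAC mulnC; apply: leq_mul => //.
  by apply: (leq_trans k1); rewrite !mulnA.
- exact: leq_trans k2 h2.
split.
- move=> a ha; have := k6 a a ha ha; rewrite inE => /andP[_].
  rewrite (_ : _ |: _ = [set f' (val i) a | i : 'I_r.+1]) //.
  apply/setP => x; apply/setU1P/imsetP => [[->|/imsetP[i _ ->]]|[i _ ->]].
  + by exists ord_max => //; rewrite /f' ltnn.
  + by exists (widen_ord (leqnSn r) i) => //; rewrite /f' /= ltn_ord.
  + rewrite /f'; case: ltnP => ir; [right|by left].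
    by apply/imsetP; exists (Ordinal ir).
- move=> i; rewrite ltnS leq_eqVlt /f' => /orP[/eqP->|ir].
    by rewrite ltnn; apply: k5.
  rewrite ir => a b ha hb /(f2 _ ir); rewrite !inE => /(_ (k3 _ ha) (k3 _ hb)).
  exact: k4.
have adj i a b : i < r -> a < s2 -> b < s2 -> G (f i (g a)) (h b).
  move=> ir ha hb; have := k6 a b ha hb; rewrite inE => /andP[/cnbrP[_ H] _].
  by apply: H; apply/imsetP; exists (Ordinal ir).
move=> i j a b; rewrite !ltnS /f' => ir jr ha hb ij.
case: (ltnP i r) => ir'; case: (ltnP j r) => jr'.
- by apply: f3 => //; apply: k3.
- exact: adj.
- by rewrite Gsym; apply: adj.
- by case/eqP: ij; apply/eqP; rewrite eqn_leq (leq_trans ir) ?(leq_trans jr).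
Qed.

End Blowup.

(** * From a rich edge to the three conclusions *)

Section Core.
Variables (T : finType) (G : rel T).
Hypotheses (Gsym : symmetric G) (Girr : irreflexive G).

Lemma cnbr2P S u v x :
  (x \in cnbr G S [set u; v]) = [&& x \in S, G u x & G v x].
Proof.
apply/cnbrP/and3P => [[xS h]|[xS ux vx]].
  by split=> //; apply: h; rewrite !inE eqxx ?orbT.
by split=> // y; rewrite !inE => /orP[] /eqP->.
Qed.

Lemma clique_add_edge u v r Q : G u v ->
  Q \in cliques G (cnbr G setT [set u; v]) r ->
  [/\ u \notin Q, v \notin Q & u |: (v |: Q) \in cliques G setT r.+2].
Proof.
move=> uv QK; have QS : Q \subset cnbr G setT [set u; v] by move: QK; rewrite inE => /and3P[].
have nb x : x \in Q -> G u x /\ G v x.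
  by move=> /(subsetP QS); rewrite cnbr2P => /and3P[].
have uQ : u \notin Q by apply/negP => /nb[]; rewrite Girr.
have vQ : v \notin Q by apply/negP => /nb[_]; rewrite Girr.
have uvne : u != v by apply: contraTneq uv => ->; rewrite Girr.
split=> //; rewrite setU1_clique //; last by rewrite !inE negb_or uvne.
rewrite setU1_clique // (subsetP (cliquesS G r (subsetT _)) _ QK) /=.
apply/andP; split; apply/cnbrP; split; rewrite ?inE // => y.
  by move=> /nb[_]; rewrite Gsym.
by case/setU1P => [->|/nb[]]; rewrite Gsym.
Qed.

Lemma js_lower_bound u v r (QQ : {set {set T}}) : G u v ->
  QQ \subset cliques G (cnbr G setT [set u; v]) r -> #|QQ| <= js G r.+2.
Proof.
move=> uv sQ.
pose through p := num_Kr_through G r.+2 p.1 p.2.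
apply: leq_trans (leq_bigmax_cond (F := through) (u, v) _) => //=; rewrite /through /=.
rewrite -(card_in_imset (f := fun Q => u |: (v |: Q))); last first.
  move=> P Q /(subsetP sQ) /(clique_add_edge uv)[uP vP _].
  move=> /(subsetP sQ) /(clique_add_edge uv)[uQ vQ _] /(congr1 (fun A => A :\: [set u; v])).
  rewrite !setUA !(setDUl [set u; v]) !setDv !set0U.
  by rewrite !(setDidPl _) // disjoint_sym disjoints_subset
     subUset !sub1set !inE ?uP ?vP ?uQ ?vQ.
apply: subset_leq_card; apply/subsetP => _ /imsetP[Q /(subsetP sQ) QK ->].
have [_ _] := clique_add_edge uv QK; rewrite !inE => /and3P[-> -> _] /=.
by rewrite !eqxx orbT.
Qed.

Lemma contains_B_rel r R : R \in cliques G setT r ->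
  contains_copy G (@B_rel r #|cnbr G setT R|).
Proof.
move=> RK; have cR := cliques_card RK.
have /is_cliqueP Rcl : is_clique G R by move: RK; rewrite inE => /and3P[].
set X := cnbr G setT R.
pose f (z : 'I_r + 'I_#|X|) : T :=
  match z with inl i => enum_val (cast_ord (esym cR) i) | inr j => enum_val j end.
have RX x y : x \in R -> y \in X -> G x y by move=> xR /cnbrP[_]; apply.
have ne x y : G x y -> x <> y by move=> + E; rewrite E Girr.
exists f; split.
  move=> [i|i] [j|j] /=; rewrite /f.
  - by move=> /enum_val_inj/cast_ord_inj ->.
  - by move/(ne _ _ (RX _ _ (enum_valP _) (enum_valP _))).
  - by move/esym/(ne _ _ (RX _ _ (enum_valP _) (enum_valP _))).
  - by move=> /enum_val_inj ->.
move=> [i|i] [j|j] //=; rewrite /f.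
- move=> ij; apply: Rcl; rewrite ?enum_valP //.
  by rewrite (inj_eq enum_val_inj) (inj_eq (@cast_ord_inj _ _ _)).
- by move=> _; apply: RX; rewrite enum_valP.
- by move=> _; rewrite Gsym; apply: RX; rewrite enum_valP.
Qed.

(** If every r-clique of W had fewer than n/C extensions in W, then W would have too few
    (r+1)-cliques. An r-clique with more extensions, together with u and v, is the clique of the
    book. *)
Lemma B_rel_of_core u v r C (QQ : {set {set T}}) : G u v ->
  QQ \subset cliques G (cnbr G setT [set u; v]) r.+1 ->
  #|T| ^ r.+1 <= C * #|QQ| ->
  exists t, #|T| <= C * t /\ contains_copy G (@B_rel r.+2 t).
Proof.
move=> uv sQ hQ; set W := cnbr G setT _ in sQ.
have n0 : 0 < #|T| by apply/card_gt0P; exists u.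
have [/existsP[Q /andP[QK hx]]|no] :=
    boolP [exists Q, (Q \in cliques G W r) && (#|T| <= C * #|cnbr G W Q|)].
  have [_ _ RK] := clique_add_edge uv QK.
  exists #|cnbr G setT (u |: (v |: Q))|; split; last exact: contains_B_rel.
  apply: (leq_trans hx); rewrite leq_mul2l subset_leq_card ?orbT //.
  apply/subsetP => x /cnbrP[]; rewrite cnbr2P => /and3P[_ ux vx] h.
  by apply/cnbrP; split; rewrite ?inE // => y /setU1P[->//|/setU1P[->//|/h]].
exfalso; move: hQ; rewrite leqNgt => /negP; apply.
apply: (@leq_ltn_trans (C * (r.+1 * #|cliques G W r.+1|))).
  rewrite leq_mul2l; apply/orP; right.
  by apply: leq_trans (subset_leq_card sQ) _; apply: leq_pmull.
rewrite card_cliquesS // big_distrr /=.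
apply: (@leq_ltn_trans (#|cliques G W r| * #|T|.-1)).
  rewrite -sum_nat_const; apply: leq_sum => Q QK.
  move: no; rewrite negb_exists => /forallP/(_ Q); rewrite QK /= -ltnNge.
  by rewrite -{1}(prednK n0) ltnS.
apply: (@leq_ltn_trans (#|T| ^ r * #|T|.-1)).
  rewrite leq_mul2r; apply/orP; right.
  apply: leq_trans (card_cliques_le Gsym Girr _ _) _.
  by case: (r) => [|r']; rewrite ?expn0 // leq_exp2r // max_card.
by rewrite expnSr ltn_pmul2l ?expn_gt0 ?n0 // prednK.
Qed.

(** [aligned_blowup_exists] gives r parts inside the common neighbourhood of u and v, with
    transversals in QQ. As these have many common neighbours, [dense_bipartite_common] gives the
    remaining part, which receives the edge uv. *)
Lemma Kplus_of_core u v r C s (QQ : {set {set T}}) : G u v ->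
  QQ \subset cliques G (cnbr G setT [set u; v]) r ->
  #|T| ^ r <= C * #|QQ| ->
  (forall Q, Q \in QQ -> #|T| <= C * #|cnbr G setT Q|) ->
  4 * C <= #|T| -> 4 ^ s <= #|T| ->
  exists t, s <= blowup_const r C * (4 * C) * t /\ contains_copy G (@Kplus_rel r.+1 t).
Proof.
move=> uv sQ hQ hx n4C n4.
have sQ' : QQ \subset cliques G setT r.
  exact: subset_trans sQ (cliquesS _ _ (subsetT _)).
have [s1 [f [h1 h2 [f1 f2 f3]]]] := aligned_blowup_exists Gsym Girr sQ' n4 hQ.
pose P a := [set f (val i) a | i : 'I_r].
have n4' : 4 ^ s1 <= #|T| by apply: leq_trans n4; rewrite leq_exp2l.
(* Removing u and v keeps the new part disjoint from them. Since 4C <= n, this costs at most half of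
   the n/C common neighbours, whence the constant 2C. *)
have [a ha|t [g [h [k1 k2 k3 [k4 k5] k6]]]] :=
  @dense_bipartite_common T s1 (2 * C)
    (fun a => cnbr G setT (P a) :\: [set u; v]) n4'.
  have := hx _ (f1 a ha); rewrite -/(P a) => h3.
  have h4 : #|cnbr G setT (P a)| <= #|cnbr G setT (P a) :\: [set u; v]| + 2.
    rewrite -(cardsID [set u; v]) addnC leq_add2l.
    apply: leq_trans (subset_leq_card (subsetIr _ _)) _.
    by rewrite cards2; case: (u != v).
  move: h3 h4 n4C; set A := #|T|; set A1 := #|cnbr _ _ _|; set A2 := #|_ :\: _|; nia.
exists t; split.
  apply: (leq_trans h1); rewrite -mulnA leq_mul2l; apply/orP; right.
  by apply: (leq_trans k1); rewrite mulnA.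
have fu i a : i < r -> a < s1 -> [/\ G u (f i a) & G v (f i a)].
  move=> ir /f1/(subsetP sQ); rewrite inE => /and3P[_ _ /subsetP/(_ (f i a))].
  by rewrite cnbr2P inE /= => H; apply/andP/H/imsetP; exists (Ordinal ir).
have fh i b c : i < r -> b < t -> c < t -> G (h c) (f i (g b)).
  move=> ir hb hc; have := k6 b c hb hc; rewrite inE => /andP[_ /cnbrP[_ H]].
  by rewrite Gsym; apply: H; apply/imsetP; exists (Ordinal ir).
have huv c : c < t -> h c != u /\ h c != v.
  by move=> hc; have := k6 c c hc hc; rewrite !inE negb_or => /andP[/andP[-> ->]].
(* The extra edge of [Kplus_rel] joins the vertices 0 and 1 of part 0, so u and v displace [h 0] and
   [h 1]. *)
pose p0 a := if a == 0 then u else if a == 1 then v else h a.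
pose F (z : 'I_r.+1 * 'I_t) : T :=
  if val z.1 is i.+1 then f i (g z.2) else p0 z.2.
have p0f i a b : i < r -> a < t -> b < t -> G (p0 a) (f i (g b)).
  move=> ir ha hb; rewrite /p0; case: eqP => _; first by have [] := fu i _ ir (k3 b hb).
  by case: eqP => _; [have [] := fu i _ ir (k3 b hb)|apply: fh].
have uvne : u != v by apply: contraTneq uv => ->; rewrite Girr.
have p0inj : {in gtn t &, injective p0}.
  move=> a b; rewrite !inE => ha hb; have [au av] := huv a ha; have [bu bv] := huv b hb.
  rewrite /p0; case: (a =P 0) => [->|_]; case: (b =P 0) => [->|_] //.
  - by case: (b == 1) => /eqP; rewrite ?(negPf uvne) // eq_sym (negPf bu).
  - by case: (a == 1) => /eqP; rewrite ?(negPf au) // eq_sym (negPf uvne).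
  case: (a =P 1) => [->|_]; case: (b =P 1) => [->|_] //.
  - by move/eqP; rewrite eq_sym (negPf bv).
  - by move/eqP; rewrite (negPf av).
  - exact: k5.
have adj x y : x.1 != y.1 -> G (F x) (F y).
  case: x y => [[[|i] hi] [a ha]] [[[|j] hj] [b hb]] //= ij; rewrite /F /=.
  - exact: p0f.
  - by rewrite Gsym; apply: p0f.
  - by apply: f3 => //; apply: k3.
exists F; split.
  move=> x y E; have x1 : x.1 = y.1.
    by apply/eqP; apply: contraT => /adj; rewrite E Girr.
  case: x y x1 E => [i [a ha]] [_ [b hb]] /= <-; rewrite /F /=.
  move=> E; congr (_, _); apply: val_inj => /=.
  case: i E => [[|i] hi] /=; first exact: p0inj.
  by move/(f2 i hi _ _ (k3 _ ha) (k3 _ hb)); apply: k4.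
move=> x y /orP[/adj //|/and3P[x0 y0]]; rewrite /F (eqP x0) (eqP y0) /p0.
by case/orP=> /andP[/eqP-> /eqP->] //=; rewrite Gsym.
Qed.

End Core.

Local Open Scope ring_scope.

(** * The Moon-Moser chain *)

Section Chain.
Variables (F : realFieldType) (T : finType) (G : rel T).
Hypotheses (Gsym : symmetric G) (Girr : irreflexive G).
Implicit Types (S Q R : {set T}) (r : nat).

Lemma sum_sqrB (I : finType) (A : {set I}) (f : I -> F) y :
  \sum_(i in A) (f i - y) ^+ 2 =
  \sum_(i in A) f i ^+ 2 - 2 * y * \sum_(i in A) f i + #|A|%:R * y ^+ 2.
Proof.
rewrite mulr_sumr [#|A|%:R * _]mulr_natl -sumr_const -sumrB -big_split /=.
by apply: eq_bigr => i _; ring.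
Qed.

Lemma sum_cliquesS (V : nmodType) S r (f : {set T} -> V) :
  (\sum_(R in cliques G S r.+1) f R) *+ r.+1 =
  \sum_(Q in cliques G S r) \sum_(v in cnbr G S Q) f (v |: Q).
Proof.
rewrite -(clique_exchange Gsym Girr S r (fun Q v => f (v |: Q))) -sumrMnl.
apply: eq_bigr => R RK; rewrite -(cliques_card RK) -sumr_const.
by apply: eq_bigr => v vR; rewrite setD1K.
Qed.

Lemma sum_cliques1 (V : nmodType) S (f : {set T} -> V) :
  \sum_(Q in cliques G S 1) f Q = \sum_(u in S) f [set u].
Proof.
have -> : cliques G S 1 = [set [set u] | u in S].
  apply/setP => Q; rewrite inE; apply/and3P/imsetP => [[/cards1P[u ->] _]|[u uS ->]].
    by rewrite sub1set => uS; exists u.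
  rewrite cards1 sub1set uS; split=> //; apply/is_cliqueP => x y.
  by rewrite !inE => /eqP-> /eqP->; rewrite eqxx.
by rewrite big_imset //= => x y _ _; apply: set1_inj.
Qed.

Lemma cnbr1 S u : cnbr G S [set u] = [set x in S | G u x].
Proof.
apply/setP => x; apply/cnbrP/idP; rewrite inE.
  by case=> -> h; rewrite h ?set11.
by case/andP=> xS ux; split=> // y /set1P->.
Qed.

Lemma sum_cliques2 (V : nmodType) S (f : {set T} -> V) :
  (\sum_(R in cliques G S 2) f R) *+ 2 =
  \sum_(u in S) \sum_(v in S | G u v) f [set u; v].
Proof.
rewrite sum_cliquesS sum_cliques1; apply: eq_bigr => u _.
rewrite cnbr1; apply: eq_big => [v|v _]; first by rewrite inE.
by rewrite setUC.
Qed.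

Definition ncl S r : F := #|cliques G S r|%:R.

(* With kappa = k, the ratio (r+1) k_{r+1} / (n k_r) equals 1 - r/k in the
   balanced complete k-partite graph. *)
Definition excess (kappa : F) S r : F :=
  r.+1%:R * ncl S r.+1 / (#|S|%:R * ncl S r) - (1 - r%:R / kappa).

Lemma moon_moser_sum S r :
  \sum_(Q in cliques G S r) #|cnbr G S Q|%:R ^+ 2 <=
  #|S|%:R * ncl S r.+1 + r%:R * (r.+2%:R * ncl S r.+2).
Proof.
have := moon_moser Gsym Girr S r; rewrite -(ler_nat F) natrD !natrM natr_sum.
by under eq_bigr do rewrite natrX.
Qed.

Lemma nclS S r : r.+1%:R * ncl S r.+1 = \sum_(Q in cliques G S r) #|cnbr G S Q|%:R.
Proof. by rewrite -natrM card_cliquesS // natr_sum. Qed.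

Lemma excessE kappa S r : 0 < #|S|%:R :> F -> 0 < ncl S r ->
  r.+1%:R * ncl S r.+1 = (excess kappa S r + (1 - r%:R / kappa)) * (#|S|%:R * ncl S r).
Proof.
move=> n0 p0; rewrite /excess subrK divfK //.
by rewrite mulf_neq0 ?gt_eqF.
Qed.

(** Let x and y be the ratios at r and r+1. Nonnegativity of the variance of the extension counts,
    combined with Moon-Moser, gives (r+1) x <= 1 + r y. The values 1 - r/kappa and 1 - (r+1)/kappa
    satisfy this with equality, so they cancel. *)
Lemma excess_step kappa S r : 0 < kappa -> 0 < #|S|%:R :> F ->
  0 < ncl S r -> 0 < ncl S r.+1 ->
  r.+1%:R * excess kappa S r <= r%:R * excess kappa S r.+1.
Proof.
move=> k0 n0 p0 p1.
have E1 := excessE kappa n0 p0; have E2 := excessE kappa n0 p1.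
have MM := moon_moser_sum S r.
set a := excess kappa S r in E1 *; set b := excess _ _ r.+1 in E2 *.
set n := #|S|%:R in n0 E1 E2 MM *.
set x := a + _ in E1; set y := b + _ in E2.
have CS : r.+1%:R * ncl S r.+1 * x * n <=
   \sum_(Q in cliques G S r) #|cnbr G S Q|%:R ^+ 2.
  have : 0 <= \sum_(Q in cliques G S r) (#|cnbr G S Q|%:R - x * n) ^+ 2.
    by apply: sumr_ge0 => Q _; apply: sqr_ge0.
  rewrite sum_sqrB -nclS -/(ncl S r) => H.
  suff E : ncl S r * (x * n) ^+ 2 = r.+1%:R * ncl S r.+1 * (x * n) by lra.
  by rewrite E1; ring.
rewrite E2 in MM.
have H : r.+1%:R * x * (n * ncl S r.+1) <= (1 + r%:R * y) * (n * ncl S r.+1).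
  by have := le_trans CS MM; rewrite mulrAC; lra.
move: H; rewrite ler_pM2r ?mulr_gt0 // /x /y -subr_ge0 -[in X in _ -> X]subr_ge0.
suff -> : 1 + r%:R * (b + (1 - r.+1%:R / kappa)) - r.+1%:R * (a + (1 - r%:R / kappa))
   = r%:R * b - r.+1%:R * a by [].
by rewrite -[r.+1]addn1 natrD; field; rewrite gt_eqF.
Qed.

(** Moon-Moser with r = 1 bounds the sum of squared degrees by n k_2 + 3 k_3, so the hypothesis
    becomes 3 k_3 > (1 - 2/kappa) n k_2. *)
Lemma excess2_gt0 kappa S : 0 < kappa ->
  2 * (1 - 1 / kappa) * ncl S 2 * #|S|%:R <
    \sum_(u in S) #|[set x in S | G u x]|%:R ^+ 2 ->
  [/\ 0 < #|S|%:R :> F, 0 < ncl S 2 & 0 < excess kappa S 2].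
Proof.
move=> k0 h; have MM := moon_moser_sum S 1.
rewrite sum_cliques1 in MM.
have {MM}MM : \sum_(u in S) #|[set x in S | G u x]|%:R ^+ 2 <=
    #|S|%:R * ncl S 2 + 3 * ncl S 3.
  apply: le_trans (le_trans MM _); last by rewrite mul1r.
  by apply: ler_sum => u _; rewrite cnbr1.
have p2 : 0 < ncl S 2.
  rewrite lt_def ler0n andbT; apply/negP => /eqP p2; move: h MM; rewrite p2.
  have : 3 * ncl S 3 = 0.
    rewrite nclS big_pred0 // => Q; apply/negbTE/negP => QK.
    by move: p2; rewrite /ncl => /eqP; rewrite pnatr_eq0 cards_eq0 => /eqP p2;
      rewrite p2 inE in QK.
  lra.
have n0 : 0 < #|S|%:R :> F.
  rewrite ltr0n card_gt0; apply/negP => /eqP S0.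
  by move: h; rewrite S0 big_set0 cards0 mulr0 ltxx.
split=> //; rewrite subr_gt0 ltr_pdivlMr ?mulr_gt0 //.
have := lt_le_trans h MM; set n := #|S|%:R; lra.
Qed.

(** For r <= k the term 1 - r/k is nonnegative, so a positive excess forces k_{r+1} > 0;
    [excess_step] then carries the excess on, as (r+1)/r >= 1. The case r = k yields a
    (k+1)-clique. *)
Lemma excess_chain k S r : (2 <= r <= k)%N ->
  0 < #|S|%:R :> F -> 0 < ncl S 2 -> 0 < excess k%:R S 2 ->
  [/\ 0 < ncl S r, 0 < ncl S r.+1 & 0 < excess k%:R S r] /\
  ((r < k)%N -> excess k%:R S r <= excess k%:R S r.+1).
Proof.
move=> /andP[r2 rk] n0 p2 e2.
have k0 : 0 < k%:R :> F by rewrite ltr0n; lia.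
have next q : (q <= k)%N -> 0 < ncl S q -> 0 < excess k%:R S q -> 0 < ncl S q.+1.
  move=> qk pq eq; have := excessE k%:R n0 pq => E.
  rewrite -(pmulr_rgt0 (x := q.+1%:R)) ?ltr0n // E !mulr_gt0 //.
  by rewrite ltr_wpDr // subr_ge0 ler_pdivrMr // mul1r ler_nat.
have step q : (0 < q)%N -> 0 < ncl S q -> 0 < ncl S q.+1 -> 0 < excess k%:R S q ->
    excess k%:R S q <= excess k%:R S q.+1.
  move=> q0 h1 h2 h3; have := excess_step k0 n0 h1 h2.
  have q0' : 0 < q%:R :> F by rewrite ltr0n.
  move=> h; rewrite -(ler_pM2l q0'); apply: le_trans _ h.
  by apply: ler_wpM2r (ltW h3) _ _ _; rewrite ler_nat.
have [h1 h3] : 0 < ncl S r /\ 0 < excess k%:R S r.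
  elim: r r2 rk => // r IH; rewrite leq_eqVlt => /orP[/eqP<- //|r2 rk].
  have [h1 h3] := IH r2 (ltnW rk); have h2 := next r (ltnW rk) h1 h3.
  by split=> //; apply: lt_le_trans h3 _; apply: step => //; lia.
have h2 := next r rk h1 h3.
by split=> // _; apply: step => //; lia.
Qed.

Lemma excess_mono k S q r : (2 <= q)%N -> (q <= r <= k)%N ->
  0 < #|S|%:R :> F -> 0 < ncl S 2 -> 0 < excess k%:R S 2 ->
  excess k%:R S q <= excess k%:R S r.
Proof.
move=> q2 /andP[qr rk] n0 p2 e2.
elim: r qr rk => [|r IH]; first by rewrite leqn0 => /eqP->.
rewrite leq_eqVlt => /orP[/eqP<- //|qr rk].
apply: le_trans (IH qr (ltnW rk)) _.
by have [|_] := @excess_chain k S r _ n0 p2 e2; [lia|apply].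
Qed.

(** For r < k the ratio is at least 1 - r/k >= 1/k, so every step gains a factor n/k. *)
Lemma ncl_lower k S r : (0 < k)%N -> (2 <= r <= k)%N ->
  0 < #|S|%:R :> F -> 0 < ncl S 2 -> 0 < excess k%:R S 2 ->
  (#|S|%:R / k%:R) ^+ (r - 2) * ncl S 2 <= r`!%:R * ncl S r.
Proof.
move=> k0 /andP[r2 rk] n0 p2 e2.
have k0' : 0 < k%:R :> F by rewrite ltr0n.
elim: r r2 rk => // r IH; rewrite leq_eqVlt => /orP[/eqP<- _|r2 rk].
  by rewrite subnn expr0; apply: ler_wpM2r (ltW p2) _ _ _; rewrite ler1n.
rewrite subSn // exprSr mulrAC.
have -> : r.+1`!%:R * ncl S r.+1 = r`!%:R * (r.+1%:R * ncl S r.+1).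
  by rewrite factS natrM; ring.
have [[h1 h2 h3] _] := @excess_chain k S r (introT andP (conj r2 (ltnW rk))) n0 p2 e2.
rewrite (excessE k%:R n0 h1).
have ek : k%:R^-1 <= excess k%:R S r + (1 - r%:R / k%:R).
  apply: ler_wpDl; first exact: ltW.
  by rewrite lerBrDr -[X in X + _]mul1r -mulrDl ler_pdivrMr // mul1r addrC natr1 ler_nat.
apply: (le_trans (ler_wpM2r (ltW (divr_gt0 n0 k0')) (IH r2 (ltnW rk)))).
have p : 0 <= r`!%:R * ncl S r * #|S|%:R by rewrite !mulr_ge0 ?ler0n.
by have := ler_wpM2l p ek; lra.
Qed.

End Chain.

(** * Stability of the degrees *)

Section Stability.
Variables (F : realFieldType) (T : finType) (g : T -> T -> F).
Hypotheses (gsym : forall u v, g u v = g v u) (g01 : forall u v, 0 <= g u v <= 1).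

Let n : F := #|T|%:R.
Definition wdeg u := \sum_v g u v.
Definition wcodeg u v := \sum_w g u w * g v w.
Definition wnonadj u v := \sum_w (1 - g u w) * (1 - g v w).
(** For an adjacency matrix g this runs over ordered edges, so each edge counts twice; [tsum] below
    runs over ordered triangles. *)
Definition esum (f : T -> T -> F) := \sum_u \sum_v g u v * f u v.

Let g0 u v : 0 <= g u v. Proof. by case/andP: (g01 u v). Qed.
Let g1 u v : g u v <= 1. Proof. by case/andP: (g01 u v). Qed.
Let n0 : 0 <= n. Proof. exact: ler0n. Qed.

Lemma sum_le_card (f : T -> F) a : (forall u, f u <= a) -> \sum_u f u <= n * a.
Proof.
move=> h; rewrite mulr_natl -sumr_const; exact: ler_sum.
Qed.

Lemma wdeg_ge0 u : 0 <= wdeg u. Proof. exact: sumr_ge0. Qed.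

Lemma wdeg_le u : wdeg u <= n.
Proof. by rewrite -[leRHS]mulr1; apply: sum_le_card. Qed.

Lemma wcodeg_le u v : wcodeg u v <= n.
Proof. by rewrite -[leRHS]mulr1; apply: sum_le_card => w; apply: mulr_ile1. Qed.

Lemma wcodegE u v : n + wcodeg u v = wdeg u + wdeg v + wnonadj u v.
Proof.
rewrite /n /wcodeg /wdeg /wnonadj -sum1_card natr_sum -!big_split /=.
by apply: eq_bigr => w _; ring.
Qed.

Lemma wnonadj_ge0 u v : 0 <= wnonadj u v.
Proof. by apply: sumr_ge0 => w _; apply: mulr_ge0; rewrite subr_ge0. Qed.

Lemma esum_le f f' : (forall u v, f u v <= f' u v) -> esum f <= esum f'.
Proof. by move=> h; do 2![apply: ler_sum => ? _]; apply: ler_wpM2l. Qed.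

Lemma esumD f f' : esum (fun u v => f u v + f' u v) = esum f + esum f'.
Proof.
rewrite /esum -big_split; apply: eq_bigr => u _; rewrite -big_split.
by apply: eq_bigr => v _; rewrite mulrDr.
Qed.

Lemma esumZ a f : esum (fun u v => a * f u v) = a * esum f.
Proof.
rewrite /esum mulr_sumr; apply: eq_bigr => u _; rewrite mulr_sumr.
by apply: eq_bigr => v _; rewrite mulrCA.
Qed.

Lemma esum_wdeg f : esum (fun u _ => f u) = \sum_u f u * wdeg u.
Proof. by apply: eq_bigr => u _; rewrite mulrC -mulr_suml. Qed.

Definition tsum (f : T -> T -> T -> F) :=
  \sum_u \sum_v \sum_w g u v * g u w * g v w * f u v w.

Lemma tsum_esum f : tsum (fun u v _ => f u v) = esum (fun u v => f u v * wcodeg u v).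
Proof.
do 2![apply: eq_bigr => ? _]; rewrite /wcodeg !mulr_sumr.
by apply: eq_bigr => w _; ring.
Qed.

Lemma tsum_swap f : tsum f = tsum (fun u v w => f u w v).
Proof.
apply: eq_bigr => u _; rewrite exchange_big /=.
do 2![apply: eq_bigr => ? _]; rewrite [g _ _ * g u _]mulrC -!mulrA.
by rewrite [X in _ * (_ * (X * _))]gsym.
Qed.

Lemma tsum_swap0 f : tsum f = tsum (fun u v w => f v u w).
Proof.
rewrite /tsum exchange_big /=; do 3![apply: eq_bigr => ? _].
by rewrite [X in X * _ * _ * _]gsym; ring.
Qed.

(** Suppose the degree sum N is below (beta n)^2. The ordered triangles starting at u number at most
    d(u)^2 and at most N; the first bound if d(u) <= beta n, and the second otherwise, is at most
    beta n d(u). *)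
Lemma wdeg_sum_lower (beta : F) : 0 <= beta ->
  beta * n * \sum_u wdeg u < esum wcodeg -> (beta * n) ^+ 2 <= \sum_u wdeg u.
Proof.
move=> b0; apply: contraTT; rewrite -ltNge -leNgt => hN.
have -> : esum wcodeg = tsum (fun _ _ _ => 1).
  by rewrite tsum_esum; do 2![apply: eq_bigr => ? _]; rewrite mul1r.
rewrite mulr_sumr; apply: ler_sum => u _.
have bn : 0 <= beta * n by exact: mulr_ge0.
case: (leP (wdeg u) (beta * n)) => hu.
  apply: (@le_trans _ _ (wdeg u * wdeg u)); last by rewrite ler_wpM2r ?wdeg_ge0.
  rewrite {1}/wdeg mulr_suml; apply: ler_sum => v _.
  rewrite /wdeg mulr_sumr; apply: ler_sum => w _.
  by rewrite mulr1 ler_piMr // mulr_ge0.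
apply: (@le_trans _ _ ((beta * n) ^+ 2)); last by rewrite expr2 ler_wpM2l // ltW.
apply: le_trans (ltW hN); rewrite /wdeg; do 2![apply: ler_sum => ? _].
by rewrite mulr1 ler_piMl // mulr_ile1.
Qed.

(* If edges have codegree close to beta n and few non-neighbours in common, then
   deg u + deg v is close to (1 + beta) n on most edges; summing over the three
   edges of a triangle isolates deg u, and vertices of small degree are caught
   by the common non-neighbourhoods. *)
Lemma degree_stability (beta kappa tau : F) :
  0 < n -> 0 < tau -> 1 <= kappa -> 1 <= kappa * beta -> beta <= 1 ->
  esum wnonadj <= tau * n ^+ 3 ->
  esum (fun u v => (wcodeg u v - beta * n) ^+ 2) <= tau ^+ 2 * n ^+ 4 ->
  n ^+ 2 <= kappa ^+ 2 * \sum_u wdeg u ->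
  \sum_u `|wdeg u - (1 + beta) / 2 * n| <= 9 * kappa ^+ 3 * tau * n ^+ 2.
Proof.
move=> np t0 k1 kb b1 H1 H2 H3.
set N2 := \sum_u wdeg u in H3.
have b0 : 0 < beta by rewrite -(pmulr_rgt0 (x := kappa)); lra.
have N2le : N2 <= n ^+ 2 by rewrite expr2; apply: sum_le_card => u; apply: wdeg_le.
pose e u v := `|wcodeg u v - beta * n|.
pose x u := `|wdeg u - (1 + beta) / 2 * n|.
pose y u v := `|wdeg u + wdeg v - (1 + beta) * n|.
have e0 u v : 0 <= e u v by exact: normr_ge0.
have x0 u : 0 <= x u by exact: normr_ge0.
have y0 u v : 0 <= y u v by exact: normr_ge0.
have xn u : x u <= n.
  have h1 := wdeg_ge0 u; have h2 := wdeg_le u.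
  rewrite /x ler_norml; apply/andP; split; nra.
have en : esum e <= tau * n ^+ 3.
  (* The inequality of arithmetic and geometric means with weight tau n turns the second moment in
     [H2] into a first moment. *)
  have h : forall u v, e u v <= tau * n / 2 + (2 * tau * n)^-1 * (wcodeg u v - beta * n) ^+ 2.
    move=> u v; rewrite -real_normK ?num_real // -/(e u v).
    rewrite -subr_ge0.
    have -> : tau * n / 2 + (2 * tau * n)^-1 * e u v ^+ 2 - e u v =
       (2 * tau * n)^-1 * (e u v - tau * n) ^+ 2 by field; rewrite !gt_eqF.
    by rewrite mulr_ge0 ?sqr_ge0 // invr_ge0 !mulr_ge0 // ltW.
  have E0 : esum (fun _ _ => tau * n / 2) = tau * n / 2 * N2.
    by rewrite mulr_sumr; exact: esum_wdeg (fun=> _).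
  apply: le_trans (esum_le h) _; rewrite (esumD (fun _ _ => tau * n / 2)) E0 esumZ.
  have h1 : (2 * tau * n)^-1 * esum (fun u v => (wcodeg u v - beta * n) ^+ 2) <=
     (2 * tau * n)^-1 * (tau ^+ 2 * n ^+ 4).
    by apply: ler_wpM2l => //; rewrite invr_ge0 !mulr_ge0 // ltW.
  have h2 : tau * n / 2 * N2 <= tau * n / 2 * n ^+ 2.
    by apply: ler_wpM2l => //; rewrite !mulr_ge0 ?invr_ge0 // ltW.
  apply: le_trans (lerD h2 h1) _; rewrite le_eqVlt; apply/orP; left; apply/eqP.
  by field; rewrite !gt_eqF.
have yn : esum y <= 2 * tau * n ^+ 3.
  have h u v : y u v <= e u v + wnonadj u v.
    have := wcodegE u v; have := wnonadj_ge0 u v; rewrite /y /e => h1 h2.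
    have -> : wdeg u + wdeg v - (1 + beta) * n = wcodeg u v - beta * n - wnonadj u v by lra.
    by apply: le_trans (ler_normB _ _) _; rewrite [X in _ + X]ger0_norm.
  apply: le_trans (esum_le h) _; rewrite esumD; lra.
have yc : esum (fun u v => y u v * wcodeg u v) <= n * (2 * tau * n ^+ 3).
  apply: (@le_trans _ _ (n * esum y)); last exact: ler_wpM2l.
  by rewrite -esumZ; apply: esum_le => u v; rewrite mulrC ler_wpM2r // wcodeg_le.
have xc : 2 * esum (fun u v => x u * wcodeg u v) <= 6 * tau * n ^+ 4.
  have -> : 2 * esum (fun u v => x u * wcodeg u v) = tsum (fun u _ _ => 2 * x u).
    by rewrite tsum_esum -esumZ; do 2![apply: eq_bigr => ? _]; ring.
  apply: (@le_trans _ _ (tsum (fun u v w => y u v + y u w + y v w))).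
    apply: ler_sum => u _; apply: ler_sum => v _; apply: ler_sum => w _.
    apply: ler_wpM2l; first by rewrite !mulr_ge0.
    rewrite -[2](@ger0_norm F 2) // -normrM.
    have -> : 2 * (wdeg u - (1 + beta) / 2 * n) = (wdeg u + wdeg v - (1 + beta) * n) +
     (wdeg u + wdeg w - (1 + beta) * n) - (wdeg v + wdeg w - (1 + beta) * n) by field.
    by apply: le_trans (ler_normB _ _) _; rewrite lerD2r ler_normD.
  have -> : tsum (fun u v w => y u v + y u w + y v w) =
     3 * esum (fun u v => y u v * wcodeg u v).
    have -> : tsum (fun u v w => y u v + y u w + y v w) =
      tsum (fun u v _ => y u v) + tsum (fun u _ w => y u w) + tsum (fun _ v w => y v w).
      rewrite /tsum -!big_split; apply: eq_bigr => u _; rewrite -!big_split.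
      by apply: eq_bigr => v _; rewrite -!big_split; apply: eq_bigr => w _; rewrite !mulrDr.
    rewrite [tsum (fun u _ w => y u w)]tsum_swap /=.
    rewrite [tsum (fun _ v w => y v w)]tsum_swap0 /= [tsum (fun u _ w => y u w)]tsum_swap /=.
    by rewrite tsum_esum; ring.
  lra.
(* Replacing the codegree weight by beta n costs only [e], and leaves the deviations [x] weighted by
   degree. *)
have xd : beta * n * esum (fun u _ => x u) <= 4 * tau * n ^+ 4.
  have h u v : beta * n * x u <= x u * wcodeg u v + n * e u v.
    have h1 : x u * e u v <= n * e u v by exact: ler_wpM2r.
    have h2 : beta * n - wcodeg u v <= e u v by rewrite /e distrC ler_norm.
    have := ler_wpM2l (x0 u) h2; lra.
  rewrite -esumZ; apply: le_trans (esum_le h) _; rewrite esumD esumZ.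
  have := ler_wpM2l n0 en; lra.
have xd' : n * esum (fun u _ => x u) <= 4 * kappa * tau * n ^+ 4.
  have p : 0 <= n * esum (fun u _ => x u).
    by rewrite mulr_ge0 // sumr_ge0 // => u _; rewrite sumr_ge0 // => v _; rewrite mulr_ge0.
  have := ler_wpM2r p kb.
  have := ler_wpM2l (le_trans ler01 k1) xd; lra.
(* [A z] counts ordered edges with both ends non-adjacent to z. At most 2 n d(z) ordered edges meet
   the neighbourhood of z, so [A z] is large when d(z) is small, while [H1] bounds the total. *)
pose A z := \sum_u \sum_v g u v * ((1 - g u z) * (1 - g v z)).
have AE : \sum_z A z = esum wnonadj.
  rewrite /A exchange_big /=; apply: eq_bigr => u _.
  rewrite exchange_big /=; apply: eq_bigr => v _.
  by rewrite -mulr_sumr.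
have A0 z : 0 <= A z.
  by do 2![apply: sumr_ge0 => ? _]; rewrite !mulr_ge0 ?subr_ge0.
have AN z : N2 - 2 * n * wdeg z <= A z.
  apply: (@le_trans _ _ (N2 - \sum_u \sum_v g u v * (g u z + g v z))).
    rewrite lerD2l lerN2.
    have -> : \sum_u \sum_v g u v * (g u z + g v z) = 2 * \sum_u g u z * wdeg u.
      have E1 : \sum_u \sum_v g u v * g u z = \sum_u g u z * wdeg u.
        by apply: eq_bigr => u _; rewrite -mulr_suml mulrC.
      have E2 : \sum_u \sum_v g u v * g v z = \sum_u g u z * wdeg u.
        rewrite exchange_big -E1; do 2![apply: eq_bigr => ? _].
        by rewrite [X in X * _]gsym.
      rewrite mulr_natl mulr2n -{1}E1 -E2 -big_split; apply: eq_bigr => u _.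
      by rewrite -big_split; apply: eq_bigr => v _; rewrite mulrDr.
    rewrite -mulrA ler_wpM2l // mulrC /wdeg mulr_suml; apply: ler_sum => u _.
    by rewrite gsym ler_wpM2l // wdeg_le.
  rewrite /A /N2 -sumrB; apply: ler_sum => u _; rewrite -sumrB; apply: ler_sum => v _.
  have h : 0 <= g u z * g v z by rewrite mulr_ge0.
  have := mulr_ge0 (g0 u v) h; lra.
(* Low degrees contribute tau n^4 and the degree-weighted sum [xd'] contributes 8 kappa tau n^4;
   [H3] later replaces [N2] by n^2 at the cost of kappa^2. *)
have xN : N2 * \sum_u x u <= 9 * kappa * tau * n ^+ 4.
  have h1 : \sum_z x z * A z <= n * (tau * n ^+ 3).
    apply: le_trans (ler_wpM2l n0 H1); rewrite -AE mulr_sumr.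
    by apply: ler_sum => z _; apply: ler_wpM2r.
  have h2 : \sum_z x z * (N2 - 2 * n * wdeg z) <= \sum_z x z * A z.
    by apply: ler_sum => z _; apply: ler_wpM2l.
  have E : \sum_z x z * (N2 - 2 * n * wdeg z) =
      N2 * \sum_u x u - 2 * (n * esum (fun u _ => x u)).
    rewrite esum_wdeg !mulr_sumr -sumrB; apply: eq_bigr => z _; ring.
  have h3 : tau * n ^+ 4 <= kappa * tau * n ^+ 4.
    by rewrite -mulrA ler_peMl // mulr_ge0 ?exprn_ge0 // ltW.
  lra.
have X0 : 0 <= \sum_u x u by exact: sumr_ge0.
have h1 := ler_wpM2r X0 H3.
have h2 := ler_wpM2l (exprn_ge0 2 (le_trans ler01 k1)) xN.
rewrite -(ler_pM2l (exprn_gt0 2 np)).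
lra.
Qed.

End Stability.

(** * Deletion of low degrees and the greedy choice *)

Section Deletion.
Variables (F : realFieldType) (T : finType) (g : T -> T -> F).
Hypotheses (gsym : forall u v, g u v = g v u) (g01 : forall u v, 0 <= g u v <= 1).

Let n : F := #|T|%:R.
Let g0 u v : 0 <= g u v. Proof. by case/andP: (g01 u v). Qed.
Let g1 u v : g u v <= 1. Proof. by case/andP: (g01 u v). Qed.

Variables (alpha delta : F).
Hypotheses (n0 : 0 < n) (alpha23 : 2 / 3 <= alpha <= 1) (delta13 : 0 < delta <= 1 / 3).
Hypothesis near : \sum_u `|wdeg g u - alpha * n| <= delta ^+ 2 / 6 * n ^+ 2.

Definition low_deg : {set T} := [set u | wdeg g u < (alpha - delta) * n].

Lemma card_low_deg : #|low_deg|%:R <= delta / 6 * n.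
Proof.
case/andP: delta13 => d0 _.
have h : delta * n * #|low_deg|%:R <= delta * n * (delta / 6 * n).
  apply: (@le_trans _ _ (\sum_u `|wdeg g u - alpha * n|)).
    2: by apply: (le_trans near); rewrite le_eqVlt; apply/orP; left; apply/eqP; ring.
  rewrite mulr_natr -sumr_const big_mkcond; apply: ler_sum => u _.
  rewrite inE; case: ifP => // h; rewrite distrC; apply: le_trans (ler_norm _); lra.
by move: h; rewrite ler_pM2l // mulr_gt0.
Qed.

(* When almost all degrees are close to alpha n, deleting a vertex of degree d
   increases sum deg^2 - alpha * (sum deg) * n by about (alpha n)^2 - d^2. *)
Lemma delete_low_deg (S := ~: low_deg) :
  alpha * (\sum_u wdeg g u) * n < \sum_u wdeg g u ^+ 2 ->
  alpha * (\sum_(u in S) \sum_(v in S) g u v) * #|S|%:R <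
    \sum_(u in S) (\sum_(v in S) g u v) ^+ 2.
Proof.
move=> hyp; have qn := card_low_deg.
have [d0 d3] := andP delta13; have [a2 a1] := andP alpha23.
set D := low_deg in S qn *; set q := #|D|%:R in qn.
have q0 : 0 <= q by exact: ler0n.
have SE (f : T -> F) : \sum_(u in S) f u = \sum_u f u - \sum_(u in D) f u.
  rewrite [\sum_u f u](bigID (mem D)) /= addrAC subrr add0r.
  by apply: eq_bigl => u; rewrite inE.
pose d := wdeg g; pose e v := \sum_(u in D) g v u.
have e0 v : 0 <= e v by exact: sumr_ge0.
have dn u : d u <= n by apply: wdeg_le.
have dd0 u : 0 <= d u by apply: wdeg_ge0.
set N2 := \sum_u wdeg g u in hyp.
pose DD := \sum_(u in D) d u.
have DDle : DD <= q * n.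
  by rewrite /q mulr_natl -sumr_const; apply: ler_sum.
have dS u : \sum_(v in S) g u v = d u - e u by rewrite SE.
have eT : \sum_v e v = DD.
  rewrite exchange_big; apply: eq_bigr => u _; apply: eq_bigr => v _; exact: gsym.
have eD : \sum_(v in D) e v <= q ^+ 2.
  rewrite expr2 /q mulr_natl -sumr_const; apply: ler_sum => v _.
  by rewrite -sumr_const; apply: ler_sum.
have N2S : \sum_(u in S) \sum_(v in S) g u v <= N2 - 2 * DD + q ^+ 2.
  under eq_bigr do rewrite dS.
  rewrite sumrB !SE eT -/N2 -/DD; lra.
have cS : #|S|%:R = n - q.
  by rewrite /n -(cardsC D) natrD addrAC subrr add0r.
(* For each deleted u, the degrees of its neighbours are replaced by alpha n; [near] bounds the
   error. *)
have de : \sum_v d v * e v <= alpha * n * DD + delta ^+ 2 / 6 * n ^+ 2 * q.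
  have -> : \sum_v d v * e v = \sum_(u in D) \sum_v g u v * d v.
    rewrite exchange_big; apply: eq_bigr => v _; rewrite mulr_sumr.
    by apply: eq_bigr => u _; rewrite mulrC gsym.
  rewrite /DD mulr_sumr /q [_ * #|D|%:R]mulr_natr -sumr_const -big_split /=.
  apply: ler_sum => u _.
  apply: (@le_trans _ _ (alpha * n * d u + \sum_v `|wdeg g v - alpha * n|)).
    2: by rewrite lerD2l.
  rewrite [d u]/wdeg mulr_sumr -big_split /=; apply: ler_sum => v _.
  have h1 := ler_norm (wdeg g v - alpha * n).
  have h2 := ler_wpM2l (g0 u v) h1.
  have h3 := ler_wpM2r (normr_ge0 (wdeg g v - alpha * n)) (g1 u v).
  rewrite /d; lra.
have sq : \sum_u wdeg g u ^+ 2 - \sum_(u in D) d u ^+ 2 - 2 * \sum_v d v * e v <=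
   \sum_(u in S) (\sum_(v in S) g u v) ^+ 2.
  have -> : \sum_(u in S) (\sum_(v in S) g u v) ^+ 2 =
     \sum_(u in S) (d u ^+ 2 - 2 * (d u * e u) + e u ^+ 2).
    by apply: eq_bigr => u _; rewrite dS; ring.
  rewrite big_split sumrB /= -mulr_sumr !SE.
  have h1 : 0 <= \sum_(u in D) d u * e u by apply: sumr_ge0 => u _; apply: mulr_ge0.
  have h2 : 0 <= \sum_(u in S) e u ^+ 2 by apply: sumr_ge0 => u _; apply: sqr_ge0.
  rewrite SE in h2; lra.
have sqD : \sum_(u in D) d u ^+ 2 <= q * ((alpha - delta) * n) ^+ 2.
  rewrite /q mulr_natl -sumr_const; apply: ler_sum => u; rewrite inE => h.
  by rewrite lerXn2r ?nnegrE ?mulr_ge0 ?(ltW n0) ?(ltW h) ?dd0 //; lra.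
have N2lo : alpha * n ^+ 2 - delta ^+ 2 / 6 * n ^+ 2 <= N2.
  have : \sum_u (alpha * n - wdeg g u) <= \sum_u `|wdeg g u - alpha * n|.
    by apply: ler_sum => u _; rewrite distrC ler_norm.
  have -> : \sum_u (alpha * n - wdeg g u) = alpha * n ^+ 2 - N2.
    by rewrite sumrB sumr_const -mulr_natr -/n; congr (_ - _); ring.
  move=> h; have := le_trans h near; lra.
have nq : 0 <= n - q by rewrite -cS ler0n.
apply: lt_le_trans sq; apply: le_lt_trans (_ : alpha * (N2 - 2 * DD + q ^+ 2) * (n - q) < _).
  rewrite cS ler_wpM2r // ler_wpM2l //; lra.
have a0 : 0 <= alpha by lra.
(* The deletion gains at least q times this quantity, plus alpha q^3. Its main part alpha^2 n^2 -
   (alpha - delta)^2 n^2 is about 2 alpha delta n^2, of which [DD] and q take at most alpha delta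
   n^2 / 2, since q <= delta n / 6. *)
suff key : 0 <= alpha * N2 - 2 * alpha * DD - alpha * q * n - ((alpha - delta) * n) ^+ 2
    - 2 * (delta ^+ 2 / 6 * n ^+ 2).
  have h1 := mulr_ge0 q0 key.
  have h2 : 0 <= alpha * q ^+ 3 by rewrite mulr_ge0 ?exprn_ge0.
  have h3 : alpha * (N2 - 2 * DD + q ^+ 2) * (n - q) = alpha * N2 * n - q * (alpha * N2)
    - 2 * alpha * n * DD + q * (2 * alpha * DD) + q * (alpha * q * n) - alpha * q ^+ 3 by ring.
  rewrite h3; lra.
have h1 := ler_wpM2l a0 N2lo.
have h2 := ler_wpM2l a0 DDle.
have h3 : alpha * q * n <= alpha * (delta / 6 * n) * n.
  by rewrite ler_wpM2r ?(ltW n0) // ler_wpM2l.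
have h4 : 0 <= (3 / 2 * alpha * delta - delta ^+ 2
    - delta ^+ 2 / 6 * alpha - 2 * (delta ^+ 2 / 6)) * n ^+ 2.
  apply: mulr_ge0; last exact: exprn_ge0 (ltW n0).
  nra.
lra.
Qed.

End Deletion.

Section RichEdge.
Variables (F : realFieldType) (T : finType) (G : rel T).
Hypotheses (Gsym : symmetric G) (Girr : irreflexive G).
Let n : F := #|T|%:R.

Definition adj u v : F := (G u v)%:R.

Lemma adj_sym u v : adj u v = adj v u. Proof. by rewrite /adj Gsym. Qed.
Lemma adj01 u v : 0 <= adj u v <= 1. Proof. by rewrite /adj ler0n lern1 leq_b1. Qed.

Lemma card_sum_nat (A : {set T}) (P : pred T) :
  #|[set x in A | P x]|%:R = \sum_(x in A) (P x)%:R :> F.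
Proof.
rewrite -sum1_card natr_sum big_mkcond [RHS]big_mkcond /=.
by apply: eq_bigr => x _; rewrite inE; case: (x \in A); case: (P x).
Qed.

Lemma wdeg_adj u : wdeg adj u = #|[set x | G u x]|%:R.
Proof.
rewrite (_ : [set x | G u x] = [set x in setT | G u x]); last by apply/setP=> x; rewrite !inE.
by rewrite card_sum_nat; apply: eq_bigl => x; rewrite inE.
Qed.

Lemma wcodeg_adj u v : wcodeg adj u v = #|cnbr G setT [set u; v]|%:R.
Proof.
rewrite (_ : cnbr G _ _ = [set x in setT | G u x && G v x]).
  rewrite card_sum_nat; apply: eq_big => x; first by rewrite inE.
  by rewrite /adj -natrM mulnb.
by apply/setP=> x; rewrite cnbr2P !inE.
Qed.

(* The number i of neighbours of a vertex in R satisfies (i - k + 1)(i - k) >= 0;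
   summing over all vertices bounds the codegrees inside R from below. *)
Lemma clique_rich_edge k (delta : F) (R : {set T}) : (0 < k)%N ->
  #|R| = k.+1 -> 0 < n -> 0 < delta ->
  {in R, forall u, (1 - 1 / k%:R - delta) * n <= wdeg adj u} ->
  exists u v, [/\ u \in R, v \in R, u != v &
    (1 - 2 / k%:R + 2 / (k%:R ^+ 2 * (k%:R + 1)) - 2 * delta) * n <= wcodeg adj u v].
Proof.
move=> k0 cR n0 d0 hd; set B := 1 - 2 / _ + _ - _.
have [/existsP[u /existsP[v /and4P[? ? ? ?]]]|no] := boolP [exists u, exists v,
   [&& u \in R, v \in R, u != v & B * n <= wcodeg adj u v]]; first by exists u, v.
exfalso.
pose i x := \sum_(u in R) adj u x.
pose K : F := k%:R.
have K0 : 0 < K by rewrite ltr0n.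
have hi x : (2 * K - 1) * i x - K * (K - 1) <= i x ^+ 2.
  rewrite /i -card_sum_nat; set m := #|_|.
  rewrite -subr_ge0.
  have -> : m%:R ^+ 2 - ((2 * K - 1) * m%:R - K * (K - 1)) =
      (m%:R - K) * (m%:R + 1 - K) by ring.
  case: (leqP k m) => h.
    have : K <= m%:R by rewrite ler_nat.
    by move=> h'; apply: mulr_ge0; lra.
  have : m%:R + 1 <= K by rewrite natr1 ler_nat.
  by move=> h'; rewrite mulr_le0 //; lra.
have Si : \sum_x i x = \sum_(u in R) wdeg adj u by rewrite exchange_big.
have Si2 : \sum_x i x ^+ 2 = \sum_(u in R) \sum_(v in R) wcodeg adj u v.
  transitivity (\sum_x \sum_(u in R) \sum_(v in R) adj u x * adj v x).
    by apply: eq_bigr => x _; rewrite expr2 mulr_suml; apply: eq_bigr => u _;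
      rewrite mulr_sumr.
  by rewrite exchange_big; apply: eq_bigr => u _; rewrite exchange_big.
have lo : (2 * K - 1) * (\sum_(u in R) wdeg adj u) - K * (K - 1) * n <= \sum_x i x ^+ 2.
  apply: (@le_trans _ _ (\sum_x ((2 * K - 1) * i x - K * (K - 1)))).
    2: by apply: ler_sum => x _; exact: hi.
  by rewrite sumrB -mulr_sumr Si sumr_const -[_ *+ #|_|]mulr_natr.
have up : \sum_(u in R) \sum_(v in R) wcodeg adj u v <=
    \sum_(u in R) wdeg adj u + (K + 1) * (K * (B * n)).
  have -> : (K + 1) * (K * (B * n)) = \sum_(u in R) K * (B * n).
    by rewrite sumr_const cR -mulr_natl natr1.
  rewrite -big_split; apply: ler_sum => u uR.
  rewrite (bigD1 u) //=; apply: lerD.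
    rewrite /wcodeg /wdeg; apply: ler_sum => x _.
    by rewrite /adj -natrM mulnb andbb.
  apply: (@le_trans _ _ (\sum_(v in R | v != u) B * n)).
    apply: ler_sum => v /andP[vR vu]; apply: ltW; rewrite ltNge.
    apply/negP => h; move/negP: no; apply; apply/existsP; exists u; apply/existsP; exists v.
    by rewrite uR vR eq_sym vu.
  rewrite sumr_const -mulr_natl (_ : #|_| = k) //.
  have := cardsD1 u R; rewrite uR cR => -[->]; apply: eq_card => v.
  by rewrite !inE andbC.
have hR : (K + 1) * ((1 - 1 / K - delta) * n) <= \sum_(u in R) wdeg adj u.
  rewrite natr1 -cR mulr_natl -sumr_const; exact: ler_sum.
rewrite Si2 in lo; have h1 := le_trans lo up.
set X := \sum_(u in R) _ in hR h1.
have K1 : 0 <= 2 * K - 2 by have : 1 <= K by [rewrite ler1n]; lra.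
have h2 := ler_wpM2l K1 hR.
(* Averaging loses only (2 - 2/K) delta; the 2 delta in [B] leaves this positive slack. *)
have h3 : (2 * K - 2) * ((K + 1) * ((1 - 1 / K - delta) * n)) - K * (K - 1) * n -
    (K + 1) * (K * (B * n)) = 2 * delta * (K + 1) * n.
  rewrite /B -/K; field; apply/andP; split; apply: lt0r_neq0; lra.
have h4 : 0 < 2 * delta * (K + 1) * n by rewrite !mulr_gt0 //; lra.
move: h1 h2 h3 h4; clear; lra.
Qed.

(** Union bound over the non-neighbours of the vertices of Q. *)
Lemma card_cnbr_ge (S Q : {set T}) (rho : F) :
  {in Q, forall w, n - wdeg adj w <= rho} ->
  #|S|%:R - #|Q|%:R * rho <= #|cnbr G S Q|%:R.
Proof.
move=> h; rewrite lerBlDr.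
have hQ : \sum_(w in Q) (n - wdeg adj w) <= #|Q|%:R * rho.
  by rewrite mulr_natl -sumr_const; apply: ler_sum.
apply: le_trans (_ : _ <= #|cnbr G S Q|%:R + \sum_(w in Q) (n - wdeg adj w)) _;
  last by rewrite lerD2l.
have E w : n - wdeg adj w = \sum_x (~~ G w x)%:R.
  rewrite /n -sum1_card natr_sum -sumrB; apply: eq_bigr => x _.
  by rewrite /adj; case: (G w x); rewrite ?subrr ?subr0.
under eq_bigr do rewrite E.
rewrite exchange_big /= card_sum_nat -sum1_card natr_sum.
apply: (@le_trans _ _ (\sum_(x in S)
    ([forall y in Q, G y x]%:R + \sum_(w in Q) (~~ G w x)%:R))).
  apply: ler_sum => x xS; have [_|] := boolP [forall y in Q, G y x].
    by rewrite lerDl sumr_ge0.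
  rewrite negb_forall_in => /exists_inP[y yQ yx].
  by rewrite add0r (bigD1 y) //= yx lerDl sumr_ge0.
rewrite big_split lerD2l [leRHS](bigID (mem S)) /= lerDl.
by apply: sumr_ge0 => x _; apply: sumr_ge0.
Qed.

Lemma greedy_cliques S r (m : F) : 0 <= m ->
  (forall s Q, (s < r)%N -> Q \in cliques G S s -> m <= #|cnbr G S Q|%:R) ->
  m ^+ r <= r`!%:R * ncl F G S r.
Proof.
move=> m0; elim: r => [|r IH] h.
  rewrite expr0 mul1r ler1n card_gt0; apply/set0Pn; exists set0.
  rewrite inE cards0 sub0set eqxx andbT; apply/is_cliqueP => u; by rewrite inE.
have -> : r.+1`!%:R * ncl F G S r.+1 = r`!%:R * (r.+1%:R * ncl F G S r.+1).
  by rewrite factS natrM; ring.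
rewrite nclS // exprSr.
apply: (@le_trans _ _ (r`!%:R * ncl F G S r * m)).
  by apply: ler_wpM2r => //; apply: IH => s Q sr; apply: h; apply: ltnW.
rewrite -mulrA; apply: ler_wpM2l => //.
rewrite /ncl mulr_natl -sumr_const; apply: ler_sum => Q QK.
exact: h QK.
Qed.

End RichEdge.

(** * Existence of a rich edge *)

Section Assembly.
Variables (F : realFieldType) (T : finType) (G : rel T).
Hypotheses (Gsym : symmetric G) (Girr : irreflexive G).
Let n : F := #|T|%:R.
Let g : T -> T -> F := adj F G.
Let gsym := adj_sym F Gsym.
Let g01 := @adj01 F T G.

(** The common neighbourhoods of the cliques in QQ are taken in the whole graph: in [Kplus_of_core]
    they supply vertices for the part of u and v, which need not be adjacent to u or v. *)
Definition rich_edge_with r (c : F) : Prop := exists u v (QQ : {set {set T}}),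
  [/\ G u v, QQ \subset cliques G (cnbr G setT [set u; v]) r,
      c * n ^+ r <= #|QQ|%:R
    & {in QQ, forall Q, c * n <= #|cnbr G setT Q|%:R}].

Lemma rich_edge_weaken r c c' : c' <= c -> rich_edge_with r c -> rich_edge_with r c'.
Proof.
move=> cc [u [v [QQ [h1 h2 h3 h4]]]]; exists u, v, QQ; split=> //.
  by apply: le_trans h3; rewrite ler_wpM2r // exprn_ge0 // ler0n.
by move=> Q /h4; apply: le_trans; rewrite ler_wpM2r // ler0n.
Qed.

(** [e Q] counts ordered pairs (u, v) completing Q to an (r+2)-clique. Since [e Q] is at most n
    times the number of common neighbours of Q, discarding the Q with fewer than cn/2 of them loses
    at most half of the total; averaging over the n^2 pairs finds u and v. *)
Lemma rich_edge_of_many_cliques r c : 0 < n -> 0 < c ->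
  c * n ^+ r.+2 <= ncl F G setT r.+2 -> rich_edge_with r (c / 4).
Proof.
move=> n0 c0 hc.
pose good := [set Q in cliques G setT r | c / 2 * n <= #|cnbr G setT Q|%:R].
pose e Q : F := \sum_(u in cnbr G setT Q) #|cnbr G setT (u |: Q)|%:R.
have cn (A : {set T}) : #|A|%:R <= n by rewrite ler_nat max_card.
have eQ Q : e Q <= #|cnbr G setT Q|%:R * n.
  by rewrite mulr_natl -sumr_const; apply: ler_sum.
have E : \sum_(Q in cliques G setT r) e Q = r.+1%:R * (r.+2%:R * ncl F G setT r.+2).
  by rewrite nclS // mulr_natl sum_cliquesS.
have tot : c * n ^+ r.+2 <= \sum_(Q in cliques G setT r) e Q.
  rewrite E mulrA; apply: (le_trans hc); rewrite ler_peMl ?ler0n //.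
  by rewrite -natrM ler1n.
have cl : ncl F G setT r <= n ^+ r.
  by rewrite /ncl /n -natrX ler_nat -cardsT card_cliques_le.
have good_tot : c / 2 * n ^+ r.+2 <= \sum_(Q in good) e Q.
  have : \sum_(Q in cliques G setT r) e Q <=
      \sum_(Q in good) e Q + ncl F G setT r * (c / 2 * n * n).
    rewrite (bigID (mem good)) /=; apply: lerD.
      rewrite le_eqVlt; apply/orP; left; apply/eqP; apply: eq_bigl => Q.
      by apply: andb_idl; rewrite /= inE => /andP[].
    apply: (@le_trans _ _ (\sum_(Q in cliques G setT r) c / 2 * n * n)).
      rewrite big_mkcondr; apply: ler_sum => Q QK; case: ifP => [|_]; last first.
        by rewrite !mulr_ge0 ?invr_ge0 // ltW.
      rewrite inE QK /= -ltNge => h; apply: le_trans (eQ Q) _.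
      by rewrite ler_wpM2r ?ltW.
    by rewrite sumr_const mulr_natl.
  have h2 : ncl F G setT r * (c / 2 * n * n) <= n ^+ r * (c / 2 * n * n).
    by rewrite ler_wpM2r // !mulr_ge0 ?invr_ge0 // ltW.
  have h3 : n ^+ r * (c / 2 * n * n) = c / 2 * n ^+ r.+2 by rewrite !exprS; ring.
  move=> h; have := le_trans tot h; rewrite h3 in h2; lra.
pose QQ u v := [set Q in good | (u \in cnbr G setT Q) && (v \in cnbr G setT (u |: Q))].
have swap : \sum_(Q in good) e Q = \sum_u \sum_v #|QQ u v|%:R.
  under [RHS]eq_bigr => u _ do under eq_bigr => v _ do rewrite card_sum_nat.
  under [RHS]eq_bigr => u _ do rewrite exchange_big /=.
  rewrite [RHS]exchange_big; apply: eq_bigr => Q _; rewrite /e big_mkcond.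
  apply: eq_bigr => u _; case: ifP => _ /=; last by rewrite big1.
  rewrite -sum1_card natr_sum big_mkcond; apply: eq_bigr => v _.
  by case: (v \in _).
have [/existsP[u /existsP[v huv]]|no] :=
    boolP [exists u, exists v, c / 4 * n ^+ r <= #|QQ u v|%:R].
  (* Nonemptiness matters: the edge uv is read off from a member of [QQ u v]. *)
  have QQ0 : (0 < #|QQ u v|)%N.
    rewrite -(ltr0n F); apply: lt_le_trans huv.
    by rewrite !mulr_gt0 ?exprn_gt0 ?invr_gt0.
  have /card_gt0P[Q0] := QQ0; rewrite inE => /and3P[_ _ /cnbrP[_ /(_ u)]].
  rewrite setU11 => /(_ isT) uv.
  exists u, v, (QQ u v); split=> //; last first.
    move=> Q; rewrite !inE => /andP[/andP[_ h] _]; apply: le_trans h.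
    by rewrite ler_wpM2r ?(ltW n0) //; lra.
  apply/subsetP => Q; rewrite inE => /and3P[+ /cnbrP[_ hu] /cnbrP[_ hv]].
  rewrite inE => /andP[+ _]; rewrite !inE => /and3P[-> -> _] /=.
  apply/subsetP => x xQ; rewrite cnbr2P inE /= (Gsym u) (Gsym v) hu //=.
  by apply: hv; rewrite setU1r.
exfalso; have : \sum_u \sum_v (#|QQ u v|%:R : F) <= \sum_(u : T) \sum_(v : T) c / 4 * n ^+ r.
  apply: ler_sum => u _; apply: ler_sum => v _; apply: ltW; rewrite ltNge.
  by apply: contra no => h; apply/existsP; exists u; apply/existsP; exists v.
rewrite -swap !sumr_const => h; have := le_trans good_tot h.
rewrite -[_ *+ _ *+ _]mulr_natr -[_ *+ _]mulr_natr -/n.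
have := exprn_gt0 r.+2 n0; rewrite !exprSr => p h'.
have := mulr_gt0 c0 p; lra.
Qed.

Lemma sum_adj_S (S : {set T}) : \sum_(u in S) \sum_(v in S) g u v = 2 * ncl F G S 2.
Proof.
rewrite nclS // sum_cliques1; apply: eq_bigr => u _.
by rewrite cnbr1 card_sum_nat.
Qed.

Lemma sum_wdeg : \sum_u wdeg g u = 2 * ncl F G setT 2.
Proof.
rewrite -sum_adj_S big_mkcond [RHS]big_mkcond; apply: eq_bigr => u _.
by rewrite inE; apply: eq_bigl => v; rewrite inE.
Qed.

Lemma esum_cliques2 (f : {set T} -> F) :
  esum g (fun u v => f [set u; v]) = 2 * \sum_(Q in cliques G setT 2) f Q.
Proof.
rewrite mulr_natl sum_cliques2 // [RHS]big_mkcond; apply: eq_bigr => u _.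
rewrite inE [RHS]big_mkcond; apply: eq_bigr => v _.
by rewrite inE /g /adj /=; case: (G u v); rewrite ?mul1r ?mul0r.
Qed.

Lemma esum_wcodeg : esum g (wcodeg g) = 2 * (3 * ncl F G setT 3).
Proof.
rewrite nclS // -esum_cliques2; do 2![apply: eq_bigr => ? _].
by rewrite wcodeg_adj.
Qed.

Lemma esum_deg_l : esum g (fun u _ => wdeg g u) = \sum_u wdeg g u ^+ 2.
Proof. by rewrite (esum_wdeg g (wdeg g)); apply: eq_bigr => u _. Qed.

Lemma esum_deg_r : esum g (fun _ v => wdeg g v) = \sum_u wdeg g u ^+ 2.
Proof.
rewrite -esum_deg_l /esum exchange_big; do 2![apply: eq_bigr => ? _].
by rewrite [X in X * _]gsym.
Qed.

(** This sums [wcodegE] over ordered edges. It shows that many non-neighbours common to the ends of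
    edges would force more triangles than a small excess allows. *)
Lemma esum_wnonadj : esum g (wnonadj g) =
  n * (2 * ncl F G setT 2) + 2 * (3 * ncl F G setT 3) - 2 * \sum_u wdeg g u ^+ 2.
Proof.
have E1 : esum g (fun _ _ => n) = n * \sum_u wdeg g u.
  by rewrite mulr_sumr; exact: (esum_wdeg g (fun=> n)).
have E2 : 2 * \sum_u wdeg g u ^+ 2 =
    esum g (fun u _ => wdeg g u) + esum g (fun _ v => wdeg g v).
  by rewrite esum_deg_l esum_deg_r; ring.
rewrite -esum_wcodeg -sum_wdeg -E1 E2.
rewrite /esum -!big_split /= -sumrB; apply: eq_bigr => u _.
rewrite -!big_split /= -sumrB; apply: eq_bigr => v _.
by have := wcodegE g u v; rewrite -/n => h; rewrite -mulrDr -mulrDr -mulrBr h;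
  congr (_ * _); ring.
Qed.

(** Moon-Moser with r = 2 bounds the second moment of the codegrees in terms of k_3 and k_4. *)
Lemma esum_codeg_dev y : esum g (fun u v => (wcodeg g u v - y) ^+ 2) <=
  2 * (n * ncl F G setT 3 + 2 * (4 * ncl F G setT 4)
       - 2 * y * (3 * ncl F G setT 3) + ncl F G setT 2 * y ^+ 2).
Proof.
have -> : esum g (fun u v => (wcodeg g u v - y) ^+ 2) =
   2 * \sum_(Q in cliques G setT 2) (#|cnbr G setT Q|%:R - y) ^+ 2.
  by rewrite -esum_cliques2; do 2![apply: eq_bigr => ? _]; rewrite wcodeg_adj.
rewrite ler_wpM2l // sum_sqrB -nclS // -/(ncl F G setT 2).
by have := @moon_moser_sum F T G Gsym Girr setT 2; rewrite cardsT -/n => h; lra.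
Qed.

End Assembly.

Section RichEdgeExists.
Variables (F : realFieldType) (r : nat) (K : F).
Hypotheses (r2 : (2 <= r)%N) (KE : K = r.+1%:R).

(* deg_gap is chosen so that 2 / (K^2 (K + 1)), the gain in clique_rich_edge, equals
   2 (K + 1) deg_gap, and deg_tol so that degree_stability bounds the total deviation of
   the degrees by deg_gap^2 / 6 * n^2, as needed in delete_low_deg. *)
Definition deg_gap : F := (K ^+ 2 * (K + 1) ^+ 2)^-1.
Definition deg_tol : F := deg_gap ^+ 2 / 6 / (9 * K ^+ 3).
Definition rich_const : F :=
  Num.min (deg_tol ^+ 2 / (r.+2`!%:R * 2 * K ^+ r.+1) / 4)
    (Num.min (deg_gap ^+ r / r`!%:R) deg_gap).

Let K3 : 3 <= K. Proof. by rewrite KE ler_nat. Qed.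
Let K0 : 0 < K. Proof. by have := K3; lra. Qed.

Lemma deg_gap_gt0 : 0 < deg_gap.
Proof. by have k3 := K3; rewrite invr_gt0 mulr_gt0 ?exprn_gt0 //; lra. Qed.

Lemma deg_gap_bound : K * (K + 1) ^+ 2 * (K * deg_gap) = 1.
Proof. have k3 := K3; rewrite /deg_gap; field; apply/andP; split; apply: lt0r_neq0; lra. Qed.

Lemma deg_gap_le : deg_gap <= 1 / 3.
Proof.
have k3 := K3; have := deg_gap_bound; have d0 := deg_gap_gt0.
have h1 : 3 <= K * (K * (K + 1) ^+ 2) by nra.
have := ler_wpM2r (ltW d0) h1; lra.
Qed.

Lemma deg_tol_gt0 : 0 < deg_tol.
Proof.
have h1 := exprn_gt0 2 deg_gap_gt0; have h2 := exprn_gt0 3 K0.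
by apply: divr_gt0; [apply: divr_gt0|apply: mulr_gt0].
Qed.

Lemma deg_tolE : 9 * K ^+ 3 * deg_tol = deg_gap ^+ 2 / 6.
Proof. have k3 := K3; rewrite /deg_tol; field; apply: lt0r_neq0; lra. Qed.

Lemma deg_tol_le : deg_tol <= 1 / 2.
Proof.
have k3 := K3; have := deg_tolE; have t0 := deg_tol_gt0.
have d0 := deg_gap_gt0; have d1 := deg_gap_le.
have h1 : 1 <= 9 * K ^+ 3.
  have : 1 <= K ^+ 3 by rewrite exprn_ege1 //; lra.
  lra.
have := ler_wpM2r (ltW t0) h1; nra.
Qed.

Lemma rich_const_gt0 : 0 < rich_const.
Proof.
have f0 m : 0 < m`!%:R :> F by rewrite ltr0n fact_gt0.
have h1 := exprn_gt0 2 deg_tol_gt0; have h2 := exprn_gt0 r.+1 K0.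
rewrite !lt_min deg_gap_gt0 (divr_gt0 (exprn_gt0 r deg_gap_gt0) (f0 r)) !andbT.
by apply: divr_gt0 => //; apply: divr_gt0 => //; do 2![apply: mulr_gt0 => //].
Qed.

Variables (T : finType) (G : rel T).
Hypotheses (Gsym : symmetric G) (Girr : irreflexive G).
Let n : F := #|T|%:R.
Let g : T -> T -> F := adj F G.
Let p s : F := ncl F G setT s.
Hypothesis hyp : 2 * (1 - 1 / K) * p 2 * n < \sum_u wdeg g u ^+ 2.

Let ex s : F := excess G K setT s.

Let chain (S : {set T}) q : (2 <= q <= r.+1)%N ->
  0 < #|S|%:R :> F -> 0 < ncl F G S 2 -> 0 < excess G K S 2 ->
  0 < ncl F G S q /\ 0 < ncl F G S q.+1.
Proof. by rewrite KE => h1 h2 h3 h4; have [[]] := excess_chain Gsym Girr h1 h2 h3 h4. Qed.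

Let base : [/\ 0 < n, 0 < p 2 & 0 < ex 2].
Proof.
have := @excess2_gt0 F T G Gsym Girr K setT K0; rewrite cardsT -/n; apply.
apply: lt_le_trans hyp _; rewrite le_eqVlt; apply/orP; left; apply/eqP.
rewrite [RHS]big_mkcond; apply: eq_bigr => u _; rewrite inE wdeg_adj.
by congr (_%:R ^+ _); apply: eq_card => x; rewrite !inE.
Qed.

Let n0 : 0 < n. Proof. by case: base. Qed.
Let nT : 0 < #|[set: T]|%:R :> F. Proof. by rewrite cardsT. Qed.
Let p20 : 0 < p 2. Proof. by case: base. Qed.
Let ex20 : 0 < ex 2. Proof. by case: base. Qed.

Let p3E : 3 * p 3 = (ex 2 + (1 - 2 / K)) * (n * p 2).
Proof. by have := excessE (G := G) K nT p20; rewrite cardsT. Qed.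

Let p30 : 0 < p 3.
Proof. by have [|_] := chain (q := 2) _ nT p20 ex20; [exact: leqW|]. Qed.

Let p4E : 4 * p 4 = (ex 3 + (1 - 3 / K)) * (n * p 3).
Proof. by have := excessE (G := G) K nT p30; rewrite cardsT. Qed.

Let beta := 1 - 2 / K.

Let Kbeta : 1 <= K * beta.
Proof.
have k3 := K3; have -> : K * beta = K - 2 by rewrite /beta; field; apply: lt0r_neq0.
by lra.
Qed.

Let beta01 : 0 <= beta <= 1.
Proof.
have := Kbeta; rewrite -{1}[1](mulfV (lt0r_neq0 K0)) ler_pM2l // => h.
have := ltW K0; rewrite -invr_ge0 => h2.
by apply/andP; split; [apply: le_trans h | rewrite /beta; lra].
Qed.

(** The positive excess at 2 says that triangles exceed the threshold of [wdeg_sum_lower], and K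
    beta >= 1. *)
Lemma edges_dense : n ^+ 2 <= K ^+ 2 * \sum_u wdeg g u.
Proof.
have [b0 _] := andP beta01.
have h : 0 < ex 2 * (n * p 2) by rewrite !mulr_gt0.
have h2 : (beta * n) ^+ 2 <= 2 * p 2.
  rewrite -sum_wdeg //; apply: (@wdeg_sum_lower F T g (@adj01 F T G)) => //.
  rewrite esum_wcodeg // sum_wdeg // -/(p 3) p3E -/(p 2) /beta -/n; lra.
have h3 := ler_wpM2l (exprn_ge0 2 (ltW K0)) h2.
rewrite sum_wdeg //; apply: le_trans h3.
have -> : K ^+ 2 * (beta * n) ^+ 2 = (K * beta) ^+ 2 * n ^+ 2 by ring.
by rewrite ler_peMl ?exprn_ege1 // exprn_ge0 // ltW.
Qed.

(** At r+1 = K the term 1 - (r+1)/K vanishes, so the excess is the whole ratio (r+2) k_{r+2} / (n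
    k_{r+1}); [ncl_lower] and [edges_dense] bound k_{r+1} below. *)
Lemma rich_edge_dense : deg_tol ^+ 2 <= ex r.+1 ->
  rich_edge_with G r (deg_tol ^+ 2 / (r.+2`!%:R * 2 * K ^+ r.+1) / 4).
Proof.
move=> he; have t0 := deg_tol_gt0.
have f0 : 0 < r.+2`!%:R :> F by rewrite ltr0n fact_gt0.
have kr := exprn_gt0 r.+1 K0; have t2 := exprn_gt0 2 t0.
have den0 : 0 < r.+2`!%:R * 2 * K ^+ r.+1 by apply: mulr_gt0 => //; apply: mulr_gt0.
apply: rich_edge_of_many_cliques => //; first exact: divr_gt0.
have [|pk _] := chain (q := r.+1) _ nT p20 ex20; first by rewrite leqnn andbT ltnS ltnW.
have E1 : r.+2%:R * p r.+2 = ex r.+1 * (n * p r.+1).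
  by have := excessE (G := G) K nT pk; rewrite cardsT -KE divff ?lt0r_neq0 // subrr addr0.
have L : (n / K) ^+ (r.+1 - 2) * p 2 <= r.+1`!%:R * p r.+1.
  have := ex20; rewrite /ex KE /n -cardsT => h; apply: ncl_lower => //.
  by rewrite leqnn andbT ltnS ltnW.
have ED := edges_dense; rewrite sum_wdeg // -/(p 2) in ED.
have L2 : n ^+ r.+1 <= 2 * K ^+ r.+1 * (r.+1`!%:R * p r.+1).
  have key m X : (n / K) ^+ m * p 2 <= X -> n ^+ (m + 2) <= 2 * K ^+ (m + 2) * X.
    move=> h; have km := exprn_gt0 m K0.
    have h1 := ler_wpM2l (ltW (exprn_gt0 m n0)) ED.
    have h2 := ler_wpM2l (exprn_ge0 2 (ltW K0)) h.
    have h3 := ler_wpM2l (ltW (mulr_gt0 (ltr0Sn F 1) km)) h2.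
    have E3 : 2 * K ^+ m * (K ^+ 2 * ((n / K) ^+ m * p 2)) = n ^+ m * (K ^+ 2 * (2 * p 2)).
      by rewrite expr_div_n; field; rewrite lt0r_neq0.
    rewrite !exprD; apply: (le_trans h1); rewrite -E3.
    by rewrite (_ : _ * X = 2 * K ^+ m * (K ^+ 2 * X)) //; ring.
  by have := key _ _ L; rewrite subnK // ltnS ltnW.
rewrite mulrAC ler_pdivrMr //.
have -> : ncl F G setT r.+2 * (r.+2`!%:R * 2 * K ^+ r.+1) =
    ex r.+1 * (n * (2 * K ^+ r.+1 * (r.+1`!%:R * p r.+1))).
  transitivity (r.+1`!%:R * 2 * K ^+ r.+1 * (r.+2%:R * p r.+2)).
    by rewrite factS natrM /p; ring.
  by rewrite E1; ring.
rewrite [n ^+ _]exprS; apply: ler_pM => //; first exact: ltW.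
  by rewrite ltW // -exprS exprn_gt0.
by rewrite ler_wpM2l // ltW.
Qed.

(** By monotonicity [ex 2] and [ex 3] are small as well, which yields both smallness assumptions of
    [degree_stability]. *)
Lemma degrees_near : ex r.+1 < deg_tol ^+ 2 ->
  \sum_u `|wdeg g u - (1 - 1 / K) * n| <= deg_gap ^+ 2 / 6 * n ^+ 2.
Proof.
have k3 := K3.
move=> he; have t0 := deg_tol_gt0; have t1 := deg_tol_le.
have ge0 : 0 <= deg_tol ^+ 2 by rewrite exprn_ge0 // ltW.
have mono q q' : (2 <= q)%N -> (q <= q' <= r.+1)%N -> ex q <= ex q'.
  have := ex20; rewrite /ex KE => h h1 h2; exact: excess_mono h.
have r3 : (2 < r.+1)%N by rewrite ltnS.
have e2 : ex 2 < deg_tol ^+ 2 by apply: le_lt_trans (mono _ _ _ _) he; rewrite ?leqnn ?(ltnW r3).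
have e3 : ex 3 < deg_tol ^+ 2 by apply: le_lt_trans (mono _ _ _ _) he; rewrite ?leqnn ?r3.
have e30 : 0 < ex 3 by apply: lt_le_trans ex20 (mono _ _ _ _); rewrite ?r3.
have N2n : 2 * p 2 <= n ^+ 2.
  rewrite -sum_wdeg // expr2; apply: sum_le_card => u; apply: wdeg_le; exact: adj01.
have [b0 b1] := andP beta01.
have t2 : deg_tol ^+ 2 <= deg_tol * (1 / 2) by rewrite expr2 ler_wpM2l // ltW.
have := @degree_stability F T g (adj_sym F Gsym) (@adj01 F T G) beta K deg_tol n0 t0 _
  Kbeta b1 _ _ edges_dense.
have -> : (1 + beta) / 2 = 1 - 1 / K by rewrite /beta; field; apply: lt0r_neq0.
rewrite deg_tolE -/n; apply.
- lra.
- rewrite esum_wnonadj // -/n -/(p 2) -/(p 3) p3E.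
  have h1 : ex 2 * (n * (2 * p 2)) <= deg_tol * (n * n ^+ 2).
    apply: ler_pM; rewrite ?(ltW ex20) ?mulr_ge0 ?(ltW n0) ?(ltW p20) //; first lra.
    by rewrite ler_wpM2l ?(ltW n0).
  have h2 := hyp; lra.
apply: (le_trans (esum_codeg_dev Gsym Girr (beta * n))); rewrite -/n -/(p 2) -/(p 3) -/(p 4).
rewrite p4E.
(* The terms free of [ex] cancel: the first factor on the right is (2/3)(ex 2 + beta) ex 3 - beta ex
   2. *)
have E : 2 * (n * p 3 + 2 * ((ex 3 + (1 - 3 / K)) * (n * p 3)) -
  2 * (beta * n) * (3 * p 3) + p 2 * (beta * n) ^+ 2) =
  ((ex 2 + beta) * (beta + 2 / 3 * ex 3) - 2 * beta * (ex 2 + beta) + beta ^+ 2)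
   * (n ^+ 2 * (2 * p 2)).
  have -> : p 3 = (ex 2 + beta) * (n * p 2) / 3 by rewrite -p3E; field.
  by rewrite /beta; field; apply: lt0r_neq0.
rewrite E (_ : n ^+ 4 = n ^+ 2 * n ^+ 2); last by ring.
apply: (@le_trans _ _ (deg_tol ^+ 2 * (n ^+ 2 * (2 * p 2)))).
  apply: ler_wpM2r; first by rewrite !mulr_ge0 ?exprn_ge0 // ltW.
  have h1 : (ex 2 + beta) * (2 / 3 * ex 3) <= (3 / 2) * (2 / 3 * deg_tol ^+ 2).
    by have e20 := ex20; apply: ler_pM; lra.
  have h2 : 0 <= ex 2 * beta by rewrite mulr_ge0 // ltW.
  nra.
by rewrite ler_wpM2l // ler_wpM2l // exprn_ge0 // ltW.
Qed.

(** After the deletion the chain, run inside S, gives a clique of order K+1 whose vertices all have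
    large degree in G. [clique_rich_edge] finds u and v in it, and the cliques are built greedily in
    their common neighbourhood within S. *)
Lemma rich_edge_near_regular : ex r.+1 < deg_tol ^+ 2 ->
  rich_edge_with G r (Num.min (deg_gap ^+ r / r`!%:R) deg_gap).
Proof.
have k3 := K3; have k0 := K0; have np := n0.
move=> he; have near := degrees_near he.
have d0 := deg_gap_gt0; have d1 := deg_gap_le.
pose alpha := 1 - 1 / K.
have Kinv : K^-1 <= 3^-1 by rewrite lef_pV2 ?posrE.
have Kinv0 : 0 < K^-1 by rewrite invr_gt0.
have a2 : 2 / 3 <= alpha <= 1 by apply/andP; split; rewrite /alpha; lra.
have d13 : 0 < deg_gap <= 1 / 3 by rewrite d0 d1.
pose D := low_deg g alpha deg_gap; pose S := ~: D.
have Dq : #|D|%:R <= deg_gap / 6 * n := card_low_deg n0 d13 near.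
have := delete_low_deg (adj_sym F Gsym) (@adj01 F T G) n0 a2 d13 near.
rewrite sum_wdeg // -/(p 2) -/n -/D -/S => del_hyp.
have {}del_hyp : alpha * (\sum_(u in S) \sum_(v in S) g u v) * #|S|%:R <
   \sum_(u in S) (\sum_(v in S) g u v) ^+ 2 by apply: del_hyp; have := hyp; rewrite /alpha; lra.
have [|nS pS eS] := @excess2_gt0 F T G Gsym Girr K S K0.
  rewrite (sum_adj_S F Gsym Girr) in del_hyp.
  rewrite (_ : \sum_(u in S) #|[set x in S | G u x]|%:R ^+ 2 =
      \sum_(u in S) (\sum_(v in S) g u v) ^+ 2);
    last by apply: eq_bigr => u _; rewrite card_sum_nat.
  move: del_hyp; rewrite /alpha; set X := \sum_(u in S) _; lra.
have [|_ pk] := chain (q := r.+1) _ nS pS eS; first by rewrite leqnn andbT ltnS ltnW.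
have /card_gt0P[R RK] : (0 < #|cliques G S r.+2|)%N by rewrite -(ltr0n F).
have RS : R \subset S by move: RK; rewrite inE => /and3P[].
have Sdeg u : u \in S -> n - wdeg g u <= (1 / K + deg_gap) * n.
  by rewrite !inE -leNgt /alpha => h; have : (1 - 1 / K - deg_gap) * n <= wdeg g u by []; lra.
have := @clique_rich_edge F T G r.+1 deg_gap R isT (cliques_card RK) n0 d0.
rewrite -KE => H; have {H}[|u [v [uR vR uv huv]]] := H.
  by move=> u /(subsetP RS); rewrite !inE -leNgt.
have Guv : G u v.
  by move: RK; rewrite inE => /and3P[_ /is_cliqueP + _]; apply.
pose W := cnbr G setT [set u; v] :&: S.
(* The gain 2(K+1) [deg_gap] less the loss 2 [deg_gap] is 2K [deg_gap]; the deleted vertices take a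
   further [deg_gap]/6. *)
have Wn : (1 - 2 / K + (2 * K - 1 / 6) * deg_gap) * n <= #|W|%:R.
  have h1 : #|cnbr G setT [set u; v]|%:R <= #|W|%:R + #|D|%:R :> F.
    rewrite -natrD ler_nat -(cardsID S (cnbr G setT [set u; v])) leq_add2l.
    by apply: subset_leq_card; apply/subsetP => x; rewrite !inE negbK => /andP[].
  move: huv; rewrite wcodeg_adj -/n.
  have -> : 2 / (K ^+ 2 * (K + 1)) = 2 * (K + 1) * deg_gap.
    rewrite /deg_gap; field; apply/andP; split; apply: lt0r_neq0; lra.
  move=> huv'; lra.
have Wdeg s Q : Q \in cliques G W s ->
    {in Q, forall w, n - wdeg g w <= (1 / K + deg_gap) * n}.
  rewrite inE => /and3P[_ _ QW] w /(subsetP QW) wW; apply: Sdeg.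
  by move: wW; rewrite inE => /andP[].
have dn : 0 < deg_gap * n by rewrite mulr_gt0.
have Kdn : 3 * (deg_gap * n) <= K * (deg_gap * n) by rewrite ler_wpM2r // ltW.
have rho0 : 0 <= (1 / K + deg_gap) * n by rewrite mulr_ge0 ?(ltW np) //; lra.
have rhoE : K * ((1 / K + deg_gap) * n) = n + K * (deg_gap * n).
  by field; apply: lt0r_neq0.
(* Each chosen vertex excludes at most (1/K + [deg_gap]) n others. As s <= K-2, at least (K + 2 -
   1/6) [deg_gap] n vertices of W remain. *)
have ext s Q : (s < r)%N -> Q \in cliques G W s -> deg_gap * n <= #|cnbr G W Q|%:R.
  move=> sr QK; apply: le_trans (card_cnbr_ge W (Wdeg s Q QK)).
  rewrite (cliques_card QK).
  have sK : s%:R <= K - 2 by rewrite KE lerBrDr -natrD ler_nat addn2 ltnS.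
  have := ler_wpM2r rho0 sK; lra.
exists u, v, (cliques G W r); split=> //.
- by apply: cliquesS; apply: subsetIl.
- have := greedy_cliques Gsym Girr (ltW dn) ext; rewrite -/(ncl F G W r) exprMn.
  have f0 : 0 < r`!%:R :> F by rewrite ltr0n fact_gt0.
  rewrite -ler_pdivrMl // => h; apply: le_trans h.
  rewrite [leRHS](_ : _ = deg_gap ^+ r / r`!%:R * n ^+ r); last by ring.
  by rewrite ler_wpM2r ?exprn_ge0 ?(ltW np) // ge_min lexx.
move=> Q QK; apply: (@le_trans _ _ (deg_gap * n)).
  by rewrite ler_wpM2r ?(ltW np) // ge_min lexx orbT.
apply: le_trans (card_cnbr_ge setT (Wdeg r Q QK)).
rewrite (cliques_card QK) cardsT -/n (_ : r%:R = K - 1); last by rewrite KE -natr1 addrK.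
(* The K-1 vertices of Q leave 1/K - (K-1) [deg_gap] of all vertices, at least [deg_gap] because K^2
   [deg_gap] <= 1. *)
have K2d : K * (K * (deg_gap * n)) <= n.
  have := deg_gap_bound => db.
  have h1 : 1 <= (K + 1) ^+ 2 by rewrite exprn_ege1 //; lra.
  have h2 := ler_wpM2r (ltW (mulr_gt0 k0 (mulr_gt0 k0 d0))) h1.
  have h3 : K * (K * deg_gap) <= 1 by lra.
  by have := ler_wpM2r (ltW np) h3; lra.
have h4 : K * (deg_gap * n) <= K^-1 * n.
  by have := ler_wpM2l (ltW Kinv0) K2d; rewrite mulKf // lt0r_neq0.
lra.
Qed.

Theorem rich_edge_exists : rich_edge_with G r rich_const.
Proof.
have [he|he] := leP (deg_tol ^+ 2) (ex r.+1).
  by apply: rich_edge_weaken (rich_edge_dense he); rewrite ge_min lexx.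
by apply: rich_edge_weaken (rich_edge_near_regular he); rewrite ge_min lexx orbT.
Qed.

End RichEdgeExists.

Local Close Scope ring_scope.

(** * Transfer to integer and real constants *)

Lemma num_edges_cliques (T : finType) (G : rel T) :
  symmetric G -> irreflexive G -> num_edges G = #|cliques G setT 2|.
Proof.
move=> Gsym Girr; apply: eq_card => e; rewrite !inE subsetT andbT.
apply/existsP/andP => [[u /existsP[v /andP[/eqP-> uv]]]|
  [/cards2P[u [v [uv ->]]] /is_cliqueP h]].
  split; first by rewrite cards2 (_ : u != v) //; apply: contraTneq uv => ->; rewrite Girr.
  apply/is_cliqueP => x y; rewrite !inE => /orP[]/eqP-> /orP[]/eqP->; rewrite ?eqxx //.
  by rewrite Gsym.
by exists u; apply/existsP; exists v; rewrite eqxx h // !inE eqxx ?orbT.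
Qed.

(** The field is instantiated with the rationals and C is an integer bound for 1/c. The bounds in
    [nat] then serve the combinatorial lemmas and pass to the reals through [INR]. *)
Lemma rich_edge_nat r : (2 <= r)%N -> exists C : nat, forall (T : finType) (G : rel T),
  simple_graph G -> (2 * r * num_edges G * #|T| < r.+1 * sum_deg2 G)%N ->
  exists u v (QQ : {set {set T}}),
  [/\ G u v, QQ \subset cliques G (cnbr G setT [set u; v]) r,
      (#|T| ^ r <= C * #|QQ|)%N
    & forall Q, Q \in QQ -> (#|T| <= C * #|cnbr G setT Q|)%N].
Proof.
move=> r2; pose K : rat := r.+1%:R%R; pose c := rich_const r K.
have c0 : (0 < c)%R by apply: rich_const_gt0.
exists (Num.bound c^-1) => T G [Gsym Girr] hyp.
have cC : (1 <= (Num.bound c^-1)%:R * c)%R.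
  by rewrite -ler_pdivrMr // div1r ltW // archi_boundP // invr_ge0 ltW.
have scale (a b : nat) : (c * a%:R <= b%:R -> (a <= Num.bound c^-1 * b)%N)%R.
  move=> h; rewrite -(ler_nat rat) natrM.
  apply: (@le_trans _ _ ((Num.bound c^-1)%:R * (c * a%:R))%R); last by rewrite ler_wpM2l.
  by rewrite mulrA ler_peMl.
have [|u [v [QQ [h1 h2 h3 h4]]]] := @rich_edge_exists rat r K r2 erefl T G Gsym Girr.
  have K0 : (0 < K)%R by rewrite ltr0n.
  rewrite -(ltr_pM2l K0) /ncl -num_edges_cliques //.
  have -> : (K * (2 * (1 - 1 / K) * (num_edges G)%:R * #|T|%:R) =
     (2 * r * num_edges G * #|T|)%:R)%R.
    have E : (r%:R = K - 1 :> rat)%R by rewrite /K -natr1 addrK.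
    by rewrite !natrM E; field; rewrite addrC natr1 pnatr_eq0.
  have -> : (\sum_u wdeg (adj rat G) u ^+ 2 = (sum_deg2 G)%:R)%R.
    by rewrite natr_sum; apply: eq_bigr => u _; rewrite natrX wdeg_adj.
  by rewrite -natrM ltr_nat.
exists u, v, QQ; split=> //.
  by apply: scale; rewrite natrX.
by move=> Q /h4; apply: scale.
Qed.

Open Scope R_scope.

Lemma INR_expn (a b : nat) : INR (a ^ b)%N = INR a ^ b.
Proof. by elim: b => // b IH; rewrite expnS mult_INR IH. Qed.

Lemma leq_INR (a b : nat) : (a <= b)%N -> INR a <= INR b.
Proof. by move/ssrnat.leP; apply: le_INR. Qed.

Lemma INR_scale (M C a b : nat) : (0 < M)%N -> (C <= M)%N -> (a <= C * b)%N ->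
  INR b >= / INR M * INR a.
Proof.
move=> M0 CM h; have M0' : 0 < INR M by apply: (lt_INR 0); apply/ssrnat.ltP.
have h1 : INR a <= INR M * INR b.
  by rewrite -mult_INR; apply: leq_INR; apply: (leq_trans h); rewrite leq_mul2r CM orbT.
apply: Rle_ge; apply: (Rmult_le_reg_l (INR M)) => //.
by rewrite -Rmult_assoc Rinv_r ?Rmult_1_l //; apply: Rgt_not_eq.
Qed.

(** With s the truncated logarithm, n < 4^(s+1) and 4 < e^3 give ln n <= 3(s+1), which is at most 6s
    as s >= 1. *)
Lemma ln_trunc_log4 n : (4 <= n)%N -> ln (INR n) <= INR (6 * trunc_log 4 n).
Proof.
move=> n4; have n0 : (0 < n)%N by apply: leq_trans n4.
have /andP[_ hn] := trunc_log_bounds (isT : 1 < 4)%N n0.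
set s := trunc_log 4 n in hn *.
have s1 : (1 <= s)%N by rewrite -(@trunc_expnK 4 1) // leq_trunc_log.
have n0' : 0 < INR n by apply: (lt_INR 0); apply/ssrnat.ltP.
have ln4 : ln 4 <= 3.
  have e3 : 1 + 3 < exp 3 by apply: exp_ineq1; Lra.lra.
  rewrite -[X in _ <= X](ln_exp 3); left; apply: ln_increasing; Lra.lra.
have h : ln (INR n) <= ln (4 ^ s.+1).
  left; apply: ln_increasing => //.
  have -> : 4 = INR 4 by rewrite /=; Lra.lra.
  by rewrite -INR_expn; apply: lt_INR; apply/ssrnat.ltP.
rewrite ln_pow in h; last by Lra.lra.
apply: (Rle_trans _ _ _ h); rewrite S_INR mult_INR.
have hs : 1 <= INR s by apply: (leq_INR s1).
have -> : INR 6 = 6 by rewrite /=; Lra.lra.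
have := Rmult_le_compat_l (INR s + 1) _ _ _ ln4; Lra.lra.
Qed.

Lemma degree_hyp_nat (k S m N : nat) : (0 < k)%N ->
  INR S > 2 * (1 - 1 / INR k) * INR m * INR N ->
  (2 * k.-1 * m * N < k * S)%N.
Proof.
case: k => // k _ h; have k0 : 0 < INR k.+1 by apply: (lt_INR 0); apply/ssrnat.ltP.
apply/ssrnat.ltP; apply: INR_lt; rewrite -[k.+1.-1]/k !mult_INR (_ : INR 2 = 2) //.
have := Rmult_lt_compat_l _ _ _ k0 h.
have -> : INR k.+1 * (2 * (1 - 1 / INR k.+1) * INR m * INR N) =
    2 * (INR k.+1 - 1) * INR m * INR N.
  transitivity (2 * (INR k.+1 - INR k.+1 * / INR k.+1) * INR m * INR N); first by Lra.lra.
  by rewrite Rinv_r //; apply: Rgt_not_eq.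
rewrite S_INR; Lra.lra.
Qed.

Theorem theorem7p2 :
  forall k : nat, (3 <= k)%N ->
  exists c : R, 0 < c /\
  exists n0 : nat,
  forall (T : finType) (G : rel T),
    simple_graph G ->
    (n0 <= #|T|)%N ->
    INR (sum_deg2 G) > 2 * (1 - 1 / INR k) * INR (num_edges G) * INR #|T| ->
    (exists t : nat, (2 <= t)%N /\ INR t >= c * ln (INR #|T|) /\
        contains_copy G (@Kplus_rel k t))
    /\ INR (js G k.+1) >= c * INR #|T| ^ (k - 1)
    /\ (exists t : nat, INR t >= c * INR #|T| /\ contains_copy G (@B_rel k t)).
Proof.
case=> [//|[//|r]] r1.
have [C hC] := rich_edge_nat (r1 : 2 <= r.+1)%N.
(* D is the loss s <= D t in [Kplus_of_core], and 6 comes from [ln_trunc_log4]; M exceeds C and 6D,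
   so 1/M serves all three conclusions. *)
set D := (blowup_const r.+1 C * (4 * C))%N.
set M := (C + 6 * D).+1.
have M0 : 0 < INR M by apply: (lt_INR 0); apply/ssrnat.ltP.
exists (/ INR M); split; first exact: Rinv_0_lt_compat.
(* The first summand gives s > D, which with s <= D t forces t >= 2; the second is the size
   condition of [Kplus_of_core]. *)
exists (4 ^ D.+1 + 4 * C)%N => T G sG hn hyp.
have [Gsym Girr] := sG.
have [u [v [QQ [uv sQ hQ hx]]]] := hC T G sG (degree_hyp_nat (isT : 0 < r.+2)%N hyp).
have nD : (4 ^ D.+1 <= #|T|)%N by apply: leq_trans hn; apply: leq_addr.
have n0 : (0 < #|T|)%N by apply: leq_trans nD; rewrite expn_gt0.
split; last split.
- pose s := trunc_log 4 #|T|.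
  have n4 : (4 <= #|T|)%N.
    by apply: leq_trans nD; rewrite expnS leq_pmulr // expn_gt0.
  have [|t [ht copy]] := Kplus_of_core Gsym Girr uv sQ hQ hx _ (trunc_logP (isT : 1 < 4)%N n0).
    by apply: leq_trans hn; apply: leq_addl.
  exists t; split; last split => //.
    have sD : (D < s)%N by rewrite /s -(@trunc_expnK 4 D.+1) // leq_trunc_log.
    rewrite ltnNge; apply/negP => t1; move: sD; rewrite ltnNge => /negP; apply.
    by apply: (leq_trans ht); rewrite -[leqRHS]muln1 leq_mul2l t1 orbT.
  have h := @INR_scale M (6 * D) (6 * s) t isT.
  have {}h : INR t >= / INR M * INR (6 * s).
    apply: h; first by rewrite leqW // leq_addl.
    by rewrite -mulnA leq_mul2l.
  apply: Rge_trans h _; apply: Rle_ge; apply: Rmult_le_compat_l.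
    exact/Rlt_le/Rinv_0_lt_compat.
  exact: ln_trunc_log4.
- rewrite subn1 -INR_expn; apply: (@INR_scale M C) => //; first by rewrite leqW // leq_addr.
  by apply: (leq_trans hQ); rewrite leq_mul2l (js_lower_bound Gsym Girr uv sQ) orbT.
have [t [ht copy]] := B_rel_of_core Gsym Girr uv sQ hQ.
by exists t; split=> //; apply: (@INR_scale M C) => //; rewrite leqW // leq_addr.
Qed.
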